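(* For $H\in(0,1)\setminus\{1/2\}$ define, for $k\ge1$, $$b_k:=\begin{cases}-\displaystyle\int_0^1 t^{2H}\cos(k\pi t)\,\mathrm{d}t, & H<1/2,\\[2mm] \dfrac{2H(2H-1)}{(k\pi)^2}\displaystyle\int_0^1 t^{2H-2}\cos(k\pi t)\,\mathrm{d}t, & H>1/2,\end{cases}$$ and for $H\in(1/2,1)$ define $$b_0:=H,\qquad a_0:=\frac{\Gamma(2-2H)}{B\left(H-\frac12,\frac32-H\right)(2H-1)} .$$ Then for every $H\in(1/2,1)$, $$\frac{b_0}{a_0}=\Gamma(2H+1)\sin(\pi H).$$ Moreover, for every $H\in(0,1)\setminus\{1/2\}$, $$b_k\sim\Gamma(2H+1)\sin(\pi H)\,(k\pi)^{-2H-1}\qquad\text{as }k\to\infty .$$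
   Context: $\Gamma$ and $B(\cdot,\cdot)$ denote the Euler Gamma and Beta functions. The notation $x_k\sim y_k$ means $x_k/y_k\to1$ as $k\to\infty$. *)

(* Defs.v *)
From mathcomp Require Import all_boot all_order all_algebra.
From mathcomp Require Import all_classical all_reals all_analysis.

Set Implicit Arguments.
Unset Strict Implicit.
Unset Printing Implicit Defensive.

Import Order.TTheory GRing.Theory Num.Theory.
Import numFieldNormedType.Exports.

Local Open Scope classical_set_scope.
Local Open Scope ring_scope.

(* Integrals are Lebesgue integrals.  An open end of the domain marks a point
   where the integrand may be singular, since x `^ y is totalized at x = 0. *)

Definition Gamma {R : realType} (x : R) : R :=
  \int[@lebesgue_measure R]_(t in `]0, +oo[) (t `^ (x - 1) * expR (- t)).

(* The library's beta_fun only takes natural-number arguments. *)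
Definition Beta {R : realType} (x y : R) : R :=
  \int[@lebesgue_measure R]_(t in `]0, 1[)
    (t `^ (x - 1) * (1 - t) `^ (y - 1)).

(* Only meaningful for 1 <= k and H in (0, 1) \ {1/2}. *)
Definition b_coef {R : realType} (H : R) (k : nat) : R :=
  if H < 1 / 2 then
    - \int[@lebesgue_measure R]_(t in `[0, 1])
        (t `^ (2 * H) * cos (k%:R * pi * t))
  else
    2 * H * (2 * H - 1) / (k%:R * pi) ^+ 2 *
      \int[@lebesgue_measure R]_(t in `]0, 1])
        (t `^ (2 * H - 2) * cos (k%:R * pi * t)).

Definition b_zero {R : realType} (H : R) : R := H.

Definition a_zero {R : realType} (H : R) : R :=
  Gamma (2 - 2 * H) / (Beta (H - 1 / 2) (3 / 2 - H) * (2 * H - 1)).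

Definition asymp_equiv {R : realType} (u v : nat -> R) : Prop :=
  (fun k => u k / v k) @ \oo --> (1 : R).

(* Main.v *)
Require Import Defs.
From mathcomp Require Import all_boot all_order all_algebra.
From mathcomp Require Import all_classical all_reals all_analysis.
From mathcomp Require Import measurable_realfun ring lra.

Import Order.TTheory GRing.Theory Num.Theory.
Import numFieldNormedType.Exports.

Local Open Scope classical_set_scope.
Local Open Scope ring_scope.

Set Implicit Arguments.
Unset Strict Implicit.
Unset Printing Implicit Defensive.

(** Everything rests on two facts about the Gamma function: the reflection
formula Gamma a * Gamma (1 - a) = pi / sin (pi * a), and the limits, for
0 < a < 1 and K = k * pi tending to infinity, of K^a times the integral over
]0, 1] of t^(a-1) cos (K t) and of t^(a-1) sin (K t).

The first claim is algebra: by reflection Beta (H - 1/2) (3/2 - H) is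
pi / sin (pi (H - 1/2)) and Gamma (2 - 2H) Gamma (2H - 1) is
pi / sin (pi (2H - 1)); the double-angle formula does the rest
([b_zero_div_a_zero]).

For the second claim, write Gamma (1 - a) t^(a-1) as the Laplace integral of
u^(-a) exp (- t u) over u > 0 and exchange the integrals ([mellin_laplace]).
Since sin K = 0 and cos K = (-1)^k, the inner integrals over t are elementary
and both oscillatory integrals become integrals over u > 0 of
u^p (1 - (-1)^k exp (- u)) / (u^2 + K^2), with p = 1 - a for the cosine and
p = - a for the sine.  The exponential contributes at most
Gamma (p + 1) / K^2, whereas the main term is exactly
K^(p-1) pi / (2 sin (pi (p + 1) / 2)), which dominates because p > -1
([integral_laplace_osc], [oscillatory_limit]).  For H > 1/2 the coefficient
[b_coef] already is such an integral with a = 2H - 1; for H < 1/2 one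
integration by parts makes it one with a = 2H ([cos_by_parts]).  Matching the
constants uses reflection once more ([b_coef_asymp]).

The reflection formula is proved without complex analysis.  Let m x be the
integral of v^(x-1) / (1 + v) over v > 0.  Tonelli gives
Gamma x * Gamma (1 - x) = m x ([eGamma_mul_onem]), and folding ]1, +oo[ onto
]0, 1[ gives m x = j x + j (1 - x), where j is the same integral over ]0, 1[.
As j y + j (y + 1) = 1 / y and 0 <= j y <= 1 / y, the number m x is the limit
of the sums of (-1)^n / (x + n) over |n| <= M ([csc_partial_sum_cvg]).  Up to
the factor sin (pi x), these sums are integrals over [0, pi] of cos (x t)
against the Dirichlet kernels.  Averaging over M turns the Dirichlet kernels
into the Fejer kernel of total mass pi, and 1 - cos (x t) <= 1 - cos t cancels
its singularity at 0, so that the averages of pi - sin (pi x) (partial sum)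
lie between 0 and 2 pi / N ([fejer_mean_bound]).  By Cesaro,
sin (pi x) * m x = pi ([mellin_div1D01_reflection]).

Integrals of nonnegative functions are kept in the extended reals, so that
exchanging them needs no integrability; a signed integrand g with |g| <= 1 is
handled through 1 + g. *)

(** * Change of variables for nonnegative integrands on open intervals *)

Section substitution.
Context {R : realType}.
Notation mu := (@lebesgue_measure R).
Implicit Types (D : set R) (F f G : R -> R) (u v : nat -> R).

Lemma derive1_continuous_on_open D F f : open D ->
  (forall x, D x -> is_derive x 1 F (f x)) ->
  (forall x, D x -> {for x, continuous f}) ->
  forall x, D x -> {for x, continuous (F^`()%classic)}.
Proof.
move=> oD dF cf x Dx; rewrite /prop_for /continuous_at.
have E y : D y -> (F^`()%classic) y = f y by move=> Dy; rewrite derive1E; apply: derive_val; exact: dF.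
have nD : \forall y \near x, D y by apply: open_nbhs_nbhs; split.
rewrite (E _ Dx); apply: cvg_trans (cf _ Dx).
apply: near_eq_cvg; near=> y; apply/esym/E.
exact: (near nD y).
Unshelve. all: by end_near. Qed.

Lemma is_derive_continuous F (f x : R) : is_derive x 1 F f -> {for x, continuous F}.
Proof. by move=> dF; apply/differentiable_continuous/derivable1_diffP/ex_derive. Qed.

Lemma within_continuous_cc F (a b : R) :
  (forall x, a <= x <= b -> {for x, continuous F}) -> {within `[a, b], continuous F}.
Proof.
move=> cF; apply: continuous_in_subspaceT => x; rewrite inE/= in_itv/=.
exact: cF.
Qed.

Lemma derivable_oo_LRcontinuous_is_derive F f (a b : R) : a <= b ->
  (forall x, a <= x <= b -> is_derive x 1 F (f x)) ->
  derivable_oo_LRcontinuous F a b.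
Proof.
move=> ab dF; split.
- move=> x; rewrite in_itv/= => /andP[ax xb].
  by apply: ex_derive; apply: dF; rewrite !ltW.
- apply: cvg_at_right_filter; apply: is_derive_continuous; apply: dF.
  by rewrite lexx.
- apply: cvg_at_left_filter; apply: is_derive_continuous; apply: dF.
  by rewrite lexx ab.
Qed.

Lemma is_derive_gt0_increasing F f (a b : R) :
  (forall x, a <= x <= b -> is_derive x 1 F (f x)) ->
  (forall x, a <= x <= b -> 0 < f x) ->
  {in `[a, b] &, {homo F : x y / x < y}}.
Proof.
move=> dF f0 x y; rewrite !in_itv/= => /andP[ax xb] /andP[ay yb] xy.
have ok z : x <= z <= y -> a <= z <= b.
  by move=> /andP[xz zy]; rewrite (le_trans ax xz) (le_trans zy yb).
have [z zxy| |c cxy] := @MVT _ F f x y xy.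
- by apply: dF; apply: ok; move: zxy; rewrite in_itv/= => /andP[/ltW-> /ltW->].
- apply: within_continuous_cc => z zxy; apply: is_derive_continuous; apply: dF.
  exact: ok.
move/eqP; rewrite subr_eq => /eqP ->; rewrite ltrDr mulr_gt0 ?subr_gt0//.
by apply: f0; apply: ok; move: cxy; rewrite in_itv/= => /andP[/ltW-> /ltW->].
Qed.

(** Both sides are limits of the integrals over the compact pieces, by monotone
convergence. *)
Lemma ge0_integral_exhaustion D E u v (u' v' : nat -> R) (g G : R -> R) :
  D = \bigcup_n `[u n, v n]%classic -> E = \bigcup_n `[u' n, v' n]%classic ->
  {homo (fun n => `[u n, v n]%classic) : m n / (m <= n)%N >-> m `<=` n} ->
  {homo (fun n => `[u' n, v' n]%classic) : m n / (m <= n)%N >-> m `<=` n} ->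
  (forall x, D x -> {for x, continuous g}) -> (forall x, D x -> 0 <= g x) ->
  (forall x, E x -> {for x, continuous G}) -> (forall x, E x -> 0 <= G x) ->
  (forall n, \int[mu]_(x in `[u' n, v' n]) (G x)%:E = \int[mu]_(x in `[u n, v n]) (g x)%:E)%E ->
  (\int[mu]_(x in E) (G x)%:E = \int[mu]_(x in D) (g x)%:E)%E.
Proof.
move=> DE EE hD hE cg g0 cG G0 eqn.
have lim (A : set R) (a b : nat -> R) (h : R -> R) : A = \bigcup_n `[a n, b n]%classic ->
    {homo (fun n => `[a n, b n]%classic) : m n / (m <= n)%N >-> m `<=` n} ->
    (forall x, A x -> {for x, continuous h}) -> (forall x, A x -> 0 <= h x) ->
    (\int[mu]_(x in `[a i, b i]) (h x)%:E)%E @[i --> \oo] --> (\int[mu]_(x in A) (h x)%:E)%E.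
  move=> AE hA ch h0; rewrite AE.
  have sub i x : x \in `[a i, b i] -> A x by move=> ?; rewrite AE; exists i.
  apply: (@ge0_nondecreasing_set_cvg_integral _ (measurableTypeR R) R (fun n => `[a n, b n]%classic) (fun x => (h x)%:E) mu).
  - by move=> m n mn; apply/subsetPset; exact: hA.
  - by move=> i; exact: measurable_itv.
  - move=> i; apply/measurable_EFinP; apply: subspace_continuous_measurable_fun => //.
    apply: within_continuous_cc => x xi; apply: ch; apply: (sub i).
    by rewrite in_itv.
  - by move=> i x xi; rewrite lee_fin; apply: h0; exact: sub xi.
have := lim _ _ _ _ DE hD cg g0; have := lim _ _ _ _ EE hE cG G0.
under eq_fun do rewrite eqn.
by move=> h1 h2; apply: (cvg_unique _ h1 h2).
Qed.

(** An open domain given with an increasing sequence of compact intervals that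
fills it: substitution is available on compact intervals, and monotone
convergence carries it to D even when the integrand is singular at the ends. *)
Definition exhausted D u v :=
  [/\ open D, forall n, u n <= v n, {homo u : m n / (m <= n)%N >-> n <= m},
     {homo v : m n / (m <= n)%N >-> m <= n} & D = \bigcup_n `[u n, v n]%classic].

Lemma exhausted_oo (a b : R) : a < b ->
  exhausted `]a, b[%classic (fun n => a + (b - a) / n.+2%:R)
    (fun n => b - (b - a) / n.+2%:R).
Proof.
move=> ab; have ba : 0 < b - a by rewrite subr_gt0.
have mono m n : (m <= n)%N -> (b - a) / n.+2%:R <= (b - a) / m.+2%:R.
  by move=> mn; rewrite ler_pM2l// lef_pV2 ?posrE ?ltr0n// ler_nat ltnS.
split.
- exact: interval_open.
- move=> n; rewrite lerBrDr -addrA -lerBrDl.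
  have := mono 0%N n isT; set e := (b - a) / n.+2%:R => he.
  rewrite [leRHS](splitr (b - a)); exact: lerD.
- by move=> m n mn; rewrite lerD2l mono.
- by move=> m n mn; rewrite lerB// mono.
rewrite eqEsubset; split => x.
  rewrite /= in_itv/= => /andP[ax xb].
  pose e := Num.min (x - a) (b - x).
  have e0 : 0 < e by rewrite lt_min !subr_gt0 ax.
  pose N := Num.truncn ((b - a) / e).
  have Nle : (b - a) / N.+2%:R <= e.
    rewrite ler_pdivrMr// -ler_pdivrMl// mulrC.
    by apply: ltW; apply: lt_trans (truncnS_gt _) _; rewrite ltr_nat.
  exists N => //=; rewrite in_itv/=; move: Nle; rewrite le_min => /andP[].
  by set d := _ / _ => h1 h2; apply/andP; split; lra.
move=> [n _] /=; rewrite !in_itv/= => /andP[h1 h2].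
have : 0 < (b - a) / n.+2%:R by rewrite divr_gt0.
by move: h1 h2; set d := _ / _ => h1 h2 d0; apply/andP; split; lra.
Qed.

Lemma exhausted_oy :
  exhausted `]0, +oo[%classic (fun n => n.+1%:R^-1) (fun n => n.+1%:R).
Proof.
split.
- exact: interval_open.
- move=> n; rewrite (@le_trans _ _ 1)//; last by rewrite ler1n.
  by rewrite invf_le1// ler1n.
- by move=> m n mn; rewrite lef_pV2 ?posrE ?ltr0n// ler_nat ltnS.
- by move=> m n mn; rewrite ler_nat ltnS.
rewrite eqEsubset; split => x.
  rewrite /= in_itv/= andbT => x0.
  exists (maxn (Num.truncn x) (Num.truncn x^-1)) => //=; rewrite in_itv/=; apply/andP; split.
    rewrite invf_ple ?posrE//; apply: ltW.
    by apply: lt_le_trans (truncnS_gt _) _; rewrite ler_nat ltnS leq_maxr.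
  by apply: ltW; apply: lt_le_trans (truncnS_gt _) _; rewrite ler_nat ltnS leq_maxl.
move=> [n _] /=; rewrite !in_itv/= andbT => /andP[h1 _].
by apply: lt_le_trans h1; rewrite invr_gt0.
Qed.

(** The pieces [u n, v n] that fill D are mapped onto intervals [F (u n), F (v n)]
that fill E, because F is increasing and onto; all analysis
takes place on these compact pieces. *)
Lemma ge0_integration_by_substitution_incr D E u v F f G :
  exhausted D u v -> (forall x, D x -> E (F x)) ->
  (forall y, E y -> exists2 x, D x & F x = y) -> is_interval E ->
  (forall x, D x -> is_derive x 1 F (f x)) ->
  (forall x, D x -> {for x, continuous f}) ->
  (forall x, D x -> 0 < f x) ->
  (forall x, E x -> {for x, continuous G}) -> (forall x, E x -> 0 <= G x) ->
  (\int[mu]_(x in E) (G x)%:E = \int[mu]_(x in D) (G (F x) * f x)%:E)%E.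
Proof.
move=> [oD uv hu hv DE] FE FE' iE dF cf f0 cG G0.
have sub i x : u i <= x <= v i -> D x by move=> ?; rewrite DE; exists i => //=; rewrite in_itv.
have incr i : {in `[u i, v i] &, {homo F : x y / x < y}}.
  apply: (@is_derive_gt0_increasing _ f) => x xi; [apply: dF|apply: f0]; exact: sub xi.
have incr' i x y : u i <= x -> x <= y -> y <= v i -> F x <= F y.
  move=> ux; rewrite le_eqVlt => /predU1P[->//|xy] yv.
  by apply/ltW/(incr i) => //; rewrite in_itv/= ?ux ?yv ?(le_trans _ yv)// ?ltW// (le_lt_trans _ xy).
have EE : E = \bigcup_n `[F (u n), F (v n)]%classic.
  rewrite eqEsubset; split => [y /FE'[x]|y [n _]].
    rewrite DE => -[i _ /=]; rewrite in_itv/= => /andP[ux xv] <-.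
    by exists i => //=; rewrite in_itv/= !(incr' i).
  by rewrite /= in_itv/=; apply: iE; apply/FE/(sub n); rewrite lexx uv.
have cF' := derive1_continuous_on_open oD dF cf.
apply: (ge0_integral_exhaustion DE EE).
- move=> m n mn x /=; rewrite !in_itv/= => /andP[/(le_trans (hu _ _ mn)) -> xv].
  exact: le_trans xv (hv _ _ mn).
- move=> m n mn x /=; rewrite !in_itv/= => /andP[ux xv].
  rewrite (le_trans _ ux) ?(le_trans xv)//; apply: (incr' n) => //.
  + by rewrite (le_trans (hu _ _ mn)).
  + exact: hv.
  + exact: hu.
  + by rewrite (le_trans _ (hv _ _ mn)).
- move=> x Dx; apply: cvgM; last exact: cf.
  apply: cvg_comp; last exact/cG/FE.
  exact/is_derive_continuous/dF.
- by move=> x Dx; rewrite mulr_ge0 ?(ltW (f0 _ Dx))// G0//; exact: FE.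
- exact: cG.
- exact: G0.
move=> n; have subn x : u n <= x <= v n -> D x by exact: sub.
rewrite integration_by_substitution_increasing//.
- apply: eq_integral => x; rewrite inE/= in_itv/= => xn; congr EFin.
  rewrite !fctE; congr (_ * _); rewrite derive1E; apply: derive_val.
  exact/dF/subn.
- by move=> x; rewrite in_itv/= => /andP[ux xv]; apply/cF'/subn; rewrite !ltW.
- apply/cvg_ex; exists ((F^`()%classic) (u n)); apply: cvg_at_right_filter; apply/cF'/subn.
  by rewrite lexx uv.
- apply/cvg_ex; exists ((F^`()%classic) (v n)); apply: cvg_at_left_filter; apply/cF'/subn.
  by rewrite lexx uv.
- by apply: derivable_oo_LRcontinuous_is_derive => // x /subn; exact: dF.
- by apply: within_continuous_cc => x xn; apply: cG; rewrite EE; exists n => //=; rewrite in_itv.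
Qed.

(** The orientation-reversing case, with the derivative of F written - f. *)
Lemma ge0_integration_by_substitution_decr D E u v F f G :
  exhausted D u v -> (forall x, D x -> E (F x)) ->
  (forall y, E y -> exists2 x, D x & F x = y) -> is_interval E ->
  (forall x, D x -> is_derive x 1 F (- f x)) ->
  (forall x, D x -> {for x, continuous f}) ->
  (forall x, D x -> 0 < f x) ->
  (forall x, E x -> {for x, continuous G}) -> (forall x, E x -> 0 <= G x) ->
  (\int[mu]_(x in E) (G x)%:E = \int[mu]_(x in D) (G (F x) * f x)%:E)%E.
Proof.
move=> [oD uv hu hv DE] FE FE' iE dF cf f0 cG G0.
have sub i x : u i <= x <= v i -> D x by move=> ?; rewrite DE; exists i => //=; rewrite in_itv.
have decr i : {in `[u i, v i] &, {homo F : x y /~ x < y}}.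
  move=> x y xi yi xy; rewrite -ltrN2; move: xi yi xy => /[swap].
  apply: (@is_derive_gt0_increasing (fun x => - F x) f) => {x y} x xi; last exact/f0/sub/xi.
  by rewrite -[f x]opprK; apply: is_deriveN; apply/dF/sub/xi.
have decr' i x y : u i <= x -> x <= y -> y <= v i -> F y <= F x.
  move=> ux; rewrite le_eqVlt => /predU1P[->//|xy] yv.
  by apply/ltW/(decr i) => //; rewrite in_itv/= ?ux ?yv ?(le_trans _ yv)// ?ltW// (le_lt_trans _ xy).
have EE : E = \bigcup_n `[F (v n), F (u n)]%classic.
  rewrite eqEsubset; split => [y /FE'[x]|y [n _]].
    rewrite DE => -[i _ /=]; rewrite in_itv/= => /andP[ux xv] <-.
    by exists i => //=; rewrite in_itv/= !(decr' i).
  by rewrite /= in_itv/=; apply: iE; apply/FE/(sub n); rewrite lexx uv.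
have cF' : forall x, D x -> {for x, continuous (F^`()%classic)}.
  by apply: (derive1_continuous_on_open oD dF) => x Dx; apply: cvgN; exact: cf.
apply: (ge0_integral_exhaustion DE EE).
- move=> m n mn x /=; rewrite !in_itv/= => /andP[/(le_trans (hu _ _ mn)) -> xv].
  exact: le_trans xv (hv _ _ mn).
- move=> m n mn x /=; rewrite !in_itv/= => /andP[ux xv].
  rewrite (le_trans _ ux) ?(le_trans xv)//; apply: (decr' n) => //.
  + exact: hu.
  + by rewrite (le_trans _ (hv _ _ mn)).
  + by rewrite (le_trans (hu _ _ mn)).
  + exact: hv.
- move=> x Dx; apply: cvgM; last exact: cf.
  apply: cvg_comp; last exact/cG/FE.
  exact/is_derive_continuous/dF.
- by move=> x Dx; rewrite mulr_ge0 ?(ltW (f0 _ Dx))// G0//; exact: FE.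
- exact: cG.
- exact: G0.
move=> n; have subn x : u n <= x <= v n -> D x by exact: sub.
rewrite integration_by_substitution_decreasing//.
- apply: eq_integral => x; rewrite inE/= in_itv/= => xn; congr EFin.
  rewrite !fctE; congr (_ * _).
  have := dF _ (subn _ xn) => dFx.
  by rewrite derive1E (@derive_val _ _ _ _ _ _ _ dFx) opprK.
- by move=> x; rewrite in_itv/= => /andP[ux xv]; apply/cF'/subn; rewrite !ltW.
- apply/cvg_ex; exists ((F^`()%classic) (u n)); apply: cvg_at_right_filter; apply/cF'/subn.
  by rewrite lexx uv.
- apply/cvg_ex; exists ((F^`()%classic) (v n)); apply: cvg_at_left_filter; apply/cF'/subn.
  by rewrite lexx uv.
- apply: (@derivable_oo_LRcontinuous_is_derive _ (fun x => - f x)) => // x /subn; exact: dF.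
- by apply: within_continuous_cc => x xn; apply: cG; rewrite EE; exists n => //=; rewrite in_itv.
Qed.

End substitution.

(** * Powers, exponentials and Tonelli on rectangles *)

Section elementary_integrals.
Context {R : realType}.
Notation mu := (@lebesgue_measure R).

Lemma powR_continuous (p x : R) : 0 < x -> {for x, continuous (fun y : R => y `^ p)}.
Proof. by move=> x0; apply: is_derive_continuous; exact: is_derive1_powR. Qed.

Lemma powRK (a x : R) : a != 0 -> 0 <= x -> (x `^ a^-1) `^ a = x.
Proof. by move=> a0 x0; rewrite -powRrM mulVf// powRr1. Qed.

(** Substituting y = x^a turns the integral, singular at 0 when a < 1, into the
length of ]0, b^a[. *)
Lemma integral_powR (a b : R) : 0 < a -> 0 < b ->
  (\int[mu]_(x in `]0%R, b[) (x `^ (a - 1))%:E = (b `^ a / a)%:E)%E.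
Proof.
move=> a0 b0.
have an0 : a != 0 by rewrite gt_eqF.
have I1 : (\int[mu]_(x in `]0%R, (b `^ a)%R[) 1%:E = (b `^ a)%:E)%E.
  rewrite integral_cst//= mul1e lebesgue_measure_itv/= lte_fin powR_gt0//.
  by rewrite oppr0 adde0.
have E1 : ((b `^ a)%:E =
    \int[mu]_(x in `]0%R, b[) (cst 1 (x `^ a) * (a * x `^ (a - 1)))%:E)%E.
rewrite -I1.
apply: (@ge0_integration_by_substitution_incr R _ _ _ _ (fun x : R => x `^ a)
  (fun x => a * x `^ (a - 1)) (cst 1) (exhausted_oo b0)).
- move=> x /=; rewrite !in_itv/= => /andP[x0 xb].
  by rewrite powR_gt0//= gt0_ltr_powR// nnegrE ltW.
- move=> y /=; rewrite in_itv/= => /andP[y0 yb]; exists (y `^ a^-1).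
    rewrite /= in_itv/= powR_gt0//= -[ltRHS](powRr1 (ltW b0)) -[X in _ < _ `^ X](mulfV an0).
    by rewrite powRrM gt0_ltr_powR// ?invr_gt0// nnegrE ?powR_ge0 ?ltW.
  by rewrite powRK ?gt_eqF// ltW.
- exact: interval_is_interval.
- by move=> x /=; rewrite in_itv/= => /andP[x0 _]; exact: is_derive1_powR.
- move=> x /=; rewrite in_itv/= => /andP[x0 _]; apply: cvgM; first exact: cvg_cst.
  exact: powR_continuous.
- by move=> x /=; rewrite in_itv/= => /andP[x0 _]; rewrite mulr_gt0// powR_gt0.
- by move=> x _; exact: cst_continuous.
- by move=> x _ /=.
rewrite EFinM E1; under [in RHS]eq_integral do rewrite /cst mul1r EFinM.
rewrite ge0_integralZl_EFin//=.
- by rewrite muleC muleA -EFinM mulVf ?gt_eqF// mul1e.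
- by move=> x _; rewrite lee_fin powR_ge0.
- apply/measurable_EFinP; apply: measurable_funTS; exact: measurable_powR.
- exact: ltW.
Qed.

Lemma integral_expR (c s : R) : 0 < c ->
  (\int[mu]_(x in `]s, +oo[) (expR (- (c * x)))%:E = (expR (- (c * s)) / c)%:E)%E.
Proof.
move=> c0; rewrite integral_itv_obnd_cbnd; last first.
  apply/measurable_EFinP; apply: measurable_funTS.
  by apply: measurableT_comp => //; apply: measurableT_comp => //; exact: measurable_funM.
have dF (x : R) : is_derive x 1 (fun x => - (expR (- (c * x)) / c)) (expR (- (c * x))).
  apply: is_derive_eq.
  by rewrite /GRing.scale/=; field; rewrite gt_eqF.
rewrite (@ge0_continuous_FTC2y _ _ (fun x => - (expR (- (c * x)) / c)) _ 0).
- by rewrite add0e EFinN oppeK.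
- by move=> x _; exact: expR_ge0.
- apply: continuous_subspaceT => x.
  apply: continuous_comp; last exact: continuous_expR.
  apply: cvgN; apply: cvgM; [exact: cvg_cst|exact: cvg_id].
- rewrite -[X in _ --> X]oppr0 -[X in - X](mul0r c^-1); apply: cvgN; apply: cvgM; last exact: cvg_cst.
  apply: (@cvg_comp _ _ _ (fun x => c * x) (fun x => expR (- x)) _ +oo%R); last exact: cvgr_expR.
  by apply: gt0_cvgMry => //; exact: cvg_id.
- by move=> x _; apply: ex_derive; exact: dF.
- by apply: cvg_at_right_filter; apply: is_derive_continuous; exact: dF.
- by move=> x _; rewrite derive1E; apply: derive_val; exact: dF.
Qed.

(** Tonelli over the whole plane, applied to the integrand cut off by the
indicator of A x B. *)
Lemma ge0_tonelli (A B : set R) (f : R -> R -> R) : measurable A -> measurable B ->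
  measurable_fun [set: R * R] (fun z => f z.1 z.2) ->
  (forall x y, A x -> B y -> 0 <= f x y) ->
  (\int[mu]_(x in A) \int[mu]_(y in B) (f x y)%:E =
   \int[mu]_(y in B) \int[mu]_(x in A) (f x y)%:E)%E.
Proof.
move=> mA mB mf f0.
pose h (z : R * R) := (f z.1 z.2 * (\1_A z.1 * \1_B z.2))%:E.
have m1A : measurable_fun setT (\1_A : R -> R) by exact: measurable_indic.
have m1B : measurable_fun setT (\1_B : R -> R) by exact: measurable_indic.
have mh : measurable_fun [set: R * R] h.
  apply/measurable_EFinP; apply: measurable_funM => //; apply: measurable_funM.
    exact: (measurableT_comp m1A (@measurable_fst _ _ R R)).
  exact: (measurableT_comp m1B (@measurable_snd _ _ R R)).
have h0 z : (0 <= h z)%E.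
  rewrite lee_fin !indicE.
  have [/set_mem zA|] := boolP (z.1 \in A); last by rewrite mul0r mulr0.
  have [/set_mem zB|] := boolP (z.2 \in B); last by rewrite !mulr0.
  by rewrite !mulr1 f0.
have := @fubini_tonelli _ _ _ _ R mu mu h mh h0.
congr (_ = _).
  rewrite [RHS]integral_mkcond; apply: eq_integral => x _.
  rewrite patchE; case: ifPn => xA.
    rewrite [RHS]integral_mkcond; apply: eq_integral => y _.
    by rewrite patchE /h/= !indicE xA; case: ifPn => yB; rewrite ?mulr1 ?mulr0 ?mul1r.
  by apply: integral0_eq => y _; rewrite /h/= !indicE (negbTE xA) mul0r mulr0.
rewrite [RHS]integral_mkcond; apply: eq_integral => x _.
rewrite patchE; case: ifPn => xA.
  rewrite [RHS]integral_mkcond; apply: eq_integral => y _.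
  by rewrite patchE /h/= !indicE xA; case: ifPn => yB; rewrite ?mulr1 ?mulr0 ?mul1r.
by apply: integral0_eq => y _; rewrite /h/= !indicE (negbTE xA) !mulr0.
Qed.

End elementary_integrals.

(** * The Gamma integral *)

Section gamma.
Context {R : realType}.
Notation mu := (@lebesgue_measure R).

(** Gamma as an extended real, so that Tonelli applies before finiteness is
known. *)
Definition eGamma (x : R) : \bar R :=
  (\int[mu]_(t in `]0%R, +oo[) (t `^ (x - 1) * expR (- t))%:E)%E.

Definition emellin_div1D (x : R) : \bar R :=
  (\int[mu]_(v in `]0%R, +oo[) (v `^ (x - 1) / (1 + v))%:E)%E.

Lemma GammaE (x : R) : Gamma x = fine (eGamma x). Proof. by []. Qed.

Lemma eGamma_ge0 x : (0 <= eGamma x)%E.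
Proof. by apply: integral_ge0 => t _; rewrite lee_fin mulr_ge0 ?powR_ge0 ?expR_ge0. Qed.

Lemma powR_gt0D (u p q : R) : 0 < u -> u `^ (p + q) = u `^ p * u `^ q.
Proof. by move=> u0; rewrite powRD// (gt_eqF u0) implybT. Qed.

Lemma powRN_cvgy0 (x : R) : 0 < x -> u `^ (- x) @[u --> +oo] --> 0.
Proof.
move=> x0; apply/cvgrPdist_le => /= e e0; near=> u.
have u0 : 0 < u by near: u; exact: nbhs_pinfty_gt.
rewrite sub0r normrN ger0_norm ?powR_ge0// powRN -[leRHS]invrK.
rewrite lef_pV2 ?posrE ?invr_gt0 ?powR_gt0//.
rewrite -[leLHS]powRr1 ?invr_ge0 ?(ltW e0)// -[X in _ `^ X](@mulVf _ x) ?gt_eqF// powRrM.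
apply: ge0_ler_powR; rewrite ?nnegrE ?powR_ge0 ?ltW//.
Unshelve. all: by end_near. Qed.

Lemma measurable_fst_comp (f : R -> R) : measurable_fun setT f ->
  measurable_fun [set: R * R] (fun z => f z.1).
Proof. by move=> mf; exact: (measurableT_comp mf (@measurable_fst _ _ R R)). Qed.

Lemma measurable_snd_comp (f : R -> R) : measurable_fun setT f ->
  measurable_fun [set: R * R] (fun z => f z.2).
Proof. by move=> mf; exact: (measurableT_comp mf (@measurable_snd _ _ R R)). Qed.

Lemma measurable_powR_fun (p : R) : measurable_fun setT (fun s : R => s `^ p).
Proof. exact: measurable_powR. Qed.

Lemma measurable_expR_prod :
  measurable_fun [set: R * R] (fun z => expR (- (z.1 * z.2))).
Proof.
have m : measurable_fun [set: R * R] (fun z => - (z.1 * z.2)).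
  by apply: measurableT_comp => //; apply: measurable_funM;
    [exact: measurable_fst|exact: measurable_snd].
have me : measurable_fun setT (@expR R) by exact: measurable_expR.
exact: (measurableT_comp me m).
Qed.

(** The Laplace transform of a power: substitute t = u s. *)
Lemma eGamma_scale (u y : R) : 0 < u ->
  (\int[mu]_(s in `]0%R, +oo[) (s `^ (y - 1) * expR (- (u * s)))%:E =
   (u `^ (- y))%:E * eGamma y)%E.
Proof.
move=> u0.
have -> : eGamma y = (\int[mu]_(s in `]0%R, +oo[)
   ((fun t => t `^ (y - 1) * expR (- t)) (u * s) * u)%:E)%E.
  apply: (@ge0_integration_by_substitution_incr R _ _ _ _ (fun s : R => u * s)
    (cst u) (fun t => t `^ (y - 1) * expR (- t)) exhausted_oy).
  - by move=> x; rewrite /= !in_itv/= !andbT => x0; rewrite mulr_gt0.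
  - move=> x; rewrite /= in_itv/= andbT => x0; exists (u^-1 * x).
      by rewrite /= in_itv/= andbT mulr_gt0 ?invr_gt0.
    by rewrite mulVKf// gt_eqF.
  - exact: interval_is_interval.
  - by move=> x _; apply: is_derive_eq; rewrite /GRing.scale/= mulr1.
  - by move=> x _; exact: cst_continuous.
  - by [].
  - move=> x; rewrite /= in_itv/= andbT => x0; apply: cvgM; first exact: powR_continuous.
    by apply: continuous_comp; [exact: opp_continuous|exact: continuous_expR].
  - by move=> x _; rewrite mulr_ge0 ?powR_ge0 ?expR_ge0.
rewrite -ge0_integralZl_EFin//=.
- apply: eq_integral => s; rewrite inE/= in_itv/= andbT => s0.
  rewrite -EFinM; congr EFin.
  rewrite powRM ?ltW//.
  rewrite [RHS](_ : _ = (u `^ (- y) * u `^ (y - 1) * u) * (s `^ (y - 1) * expR (- (u * s)))); last by ring.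
  rewrite -!powR_gt0D//.
  by rewrite (_ : - y + (y - 1) = -1); [rewrite powR_inv1 ?ltW// mulVf ?gt_eqF// mul1r|ring].
- by move=> s _; rewrite lee_fin !mulr_ge0 ?powR_ge0 ?expR_ge0// ltW.
- apply/measurable_EFinP; apply: measurable_funTS; apply: measurable_funM => //.
  have mu' : measurable_fun [set: R] (fun s => u * s) by exact: measurable_funM.
  apply: measurable_funM; first exact: (measurableT_comp (measurable_powR_fun (y - 1)) mu').
  by apply: measurableT_comp => //; exact: measurableT_comp.
- exact: powR_ge0.
Qed.

Lemma integral_powR_tail (x : R) : 0 < x ->
  (\int[mu]_(u in `]1%R, +oo[) (u `^ (- x - 1))%:E = (x^-1)%:E)%E.
Proof.
move=> x0.
have dF (u : R) : 1 <= u ->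
    is_derive u 1 (fun u : R => - (u `^ (- x) / x)) (u `^ (- x - 1)).
  move=> u1; have u0 : 0 < u by rewrite (lt_le_trans _ u1).
  have := is_derive1_powR (- x) u0 => d.
  by apply: is_derive_eq; rewrite /GRing.scale/=; field; rewrite gt_eqF.
rewrite integral_itv_obnd_cbnd; last first.
  by apply/measurable_EFinP; apply: measurable_funTS; exact: measurable_powR.
rewrite (@ge0_continuous_FTC2y _ _ (fun u : R => - (u `^ (- x) / x)) _ 0).
- by rewrite powR1 mul1r -EFinB sub0r opprK.
- by move=> u _; exact: powR_ge0.
- apply: continuous_in_subspaceT => u; rewrite inE/= in_itv/= andbT => u1.
  by apply: powR_continuous; rewrite (lt_le_trans _ u1).
- rewrite -[X in _ --> X]oppr0; apply: cvgN; rewrite -[X in _ --> X](mul0r x^-1).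
  by apply: cvgM; [exact: powRN_cvgy0|exact: cvg_cst].
- by move=> u u1; apply: ex_derive; apply: dF; exact: ltW.
- by apply: cvg_at_right_filter; exact: (is_derive_continuous (dF 1 (lexx 1))).
- move=> u; rewrite in_itv/= andbT => u1; rewrite derive1E; apply: derive_val; apply: dF; exact: ltW.
Qed.

(** Multiply Gamma (x + 1) by 1 / x, the integral of u^(-x-1) over u > 1. By
[eGamma_scale] the product is a double integral of s^x exp (- u s), and
integrating in u first leaves s^(x-1) exp (- s). *)
Lemma eGamma_add1 (x : R) : 0 < x -> (eGamma (x + 1) = x%:E * eGamma x)%E.
Proof.
move=> x0.
suff E : (eGamma (x + 1) * (x^-1)%:E = eGamma x)%E.
  by rewrite -E muleC -muleA -EFinM mulVf ?gt_eqF// mule1.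
rewrite muleC -integral_powR_tail//.
rewrite -ge0_integralZr//=.
- under eq_integral.
    move=> u; rewrite inE/= in_itv/= andbT => u1.
    have u0 : 0 < u by rewrite (lt_trans _ u1).
    rewrite (_ : - x - 1 = - (x + 1)); last by ring.
    rewrite -eGamma_scale// addrK; over.
  rewrite (@ge0_tonelli R _ _ (fun u s => s `^ x * expR (- (u * s))))//=.
  + apply: eq_integral => s; rewrite inE/= in_itv/= andbT => s0.
    under eq_integral do rewrite EFinM mulrC.
    rewrite ge0_integralZl_EFin ?powR_ge0//=.
    * rewrite integral_expR// mulr1 -EFinM; congr EFin.
      rewrite powR_gt0D// powR_inv1 ?ltW//; ring.
    * apply/measurable_EFinP; apply: measurable_funTS.
      by apply: measurableT_comp => //; apply: measurableT_comp => //; exact: measurable_funM.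
  + apply: measurable_funM; last exact: measurable_expR_prod.
    exact: (measurable_snd_comp (measurable_powR_fun x)).
  + by move=> *; rewrite mulr_ge0 ?powR_ge0 ?expR_ge0.
- by apply/measurable_EFinP; apply: measurable_funTS; exact: measurable_powR.
- by move=> u _; rewrite lee_fin powR_ge0.
- exact: eGamma_ge0.
Qed.

(** Substituting the variable of Gamma x by t s in the double integral gives
s^(x-1) exp (- t (1 + s)); integrating in t leaves s^(x-1) / (1 + s). *)
Lemma eGamma_mul_onem (x : R) : (eGamma x * eGamma (1 - x) = emellin_div1D x)%E.
Proof.
rewrite [X in (_ * X)%E]/eGamma -ge0_integralZl//=; last 3 first.
- apply/measurable_EFinP; apply: measurable_funTS; apply: measurable_funM; first exact: measurable_powR.
  by apply: measurableT_comp.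
- by move=> t _; rewrite lee_fin mulr_ge0 ?powR_ge0 ?expR_ge0.
- exact: eGamma_ge0.
under eq_integral.
  move=> t; rewrite inE/= in_itv/= andbT => t0.
  rewrite (_ : 1 - x - 1 = - x); last by ring.
  rewrite EFinM muleA [X in (X * _)%E]muleC -eGamma_scale// muleC -ge0_integralZl_EFin ?expR_ge0//=; last 2 first.
    by move=> s _; rewrite lee_fin mulr_ge0 ?powR_ge0 ?expR_ge0.
    apply/measurable_EFinP; apply: measurable_funTS; apply: measurable_funM; first exact: measurable_powR.
    by apply: measurableT_comp => //; apply: measurableT_comp => //; exact: measurable_funM.
  under eq_integral do rewrite -EFinM.
  over.
rewrite (@ge0_tonelli R _ _ (fun t s => expR (- t) * (s `^ (x - 1) * expR (- (t * s)))))//=; last 2 first.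
- apply: measurable_funM; last first.
    apply: measurable_funM; last exact: measurable_expR_prod.
    exact: (measurable_snd_comp (measurable_powR_fun (x - 1))).
  apply: (@measurable_fst_comp (fun t => expR (- t))).
  by apply: measurableT_comp.
- by move=> *; rewrite !mulr_ge0 ?powR_ge0 ?expR_ge0.
apply: eq_integral => s; rewrite inE/= in_itv/= andbT => s0.
have s1 : 0 < 1 + s by rewrite addr_gt0.
under eq_integral.
  move=> t _.
  rewrite mulrCA -expRD (_ : - t + - (t * s) = - ((1 + s) * t)); last by ring.
  rewrite EFinM; over.
rewrite ge0_integralZl_EFin ?powR_ge0//=.
- by rewrite integral_expR// mulr0 oppr0 expR0 mul1r.
- apply/measurable_EFinP; apply: measurable_funTS.
  by apply: measurableT_comp => //; apply: measurableT_comp => //; exact: measurable_funM.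
Qed.

End gamma.

(** * The integral of v^(x-1) / (1 + v) *)

Section mellin.
Context {R : realType}.
Notation mu := (@lebesgue_measure R).

Definition emellin_div1D01 (y : R) : \bar R :=
  (\int[mu]_(v in `]0%R, 1%R[) (v `^ (y - 1) / (1 + v))%:E)%E.

Lemma powR_continuous_div1D (p x : R) : 0 < x ->
  {for x, continuous (fun v : R => v `^ p / (1 + v))}.
Proof.
move=> x0; apply: cvgM; first exact: powR_continuous.
apply: cvgV; first by rewrite gt_eqF// addr_gt0.
by apply: cvgD; [exact: cvg_cst|exact: cvg_id].
Qed.

Lemma measurable_continuous_pos (D : set R) (f : R -> R) : D `<=` `]0, +oo[%classic ->
  (forall x, 0 < x -> {for x, continuous f}) -> measurable_fun D (fun x => (f x)%:E).
Proof.
move=> D0 cf; apply/measurable_EFinP; apply: (measurable_funS _ D0); first exact: measurable_itv.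
apply: open_continuous_measurable_fun; first exact: interval_open.
by move=> x; rewrite inE/= in_itv/= andbT => x0; exact: cf.
Qed.

Lemma measurable_powR_div1D (p : R) (D : set R) : D `<=` `]0, +oo[%classic ->
  measurable_fun D (fun v : R => (v `^ p / (1 + v))%:E).
Proof.
by move=> D0; apply: measurable_continuous_pos => // x x0; exact: powR_continuous_div1D.
Qed.

Lemma powR_div1D_ge0 (p v : R) : 0 < v -> 0 <= v `^ p / (1 + v).
Proof. by move=> v0; rewrite divr_ge0 ?powR_ge0// addr_ge0// ltW. Qed.

(** The part over ]1, +oo[ is folded onto ]0, 1[ by v := 1 / v, which replaces
x by 1 - x. *)
Lemma emellin_div1D_split (x : R) : (emellin_div1D x = emellin_div1D01 x + emellin_div1D01 (1 - x))%E.
Proof.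
rewrite /emellin_div1D.
have -> : `]0%R, +oo[%classic = `]0%R, 1%R] `|` `]1%R, +oo[%classic :> set R.
  rewrite eqEsubset; split => v /=; rewrite !in_itv/= !andbT.
    by move=> v0; have [v1|v1] := leP v 1; [left; rewrite v0|right].
  by move=> [/andP[]//|]; apply: lt_trans.
rewrite ge0_integral_setU//=; last 3 first.
- apply: measurable_powR_div1D => v [] /=; rewrite !in_itv/= ?andbT.
    by case/andP.
  exact: lt_trans.
- move=> v; rewrite !in_itv/= andbT => v0; rewrite lee_fin powR_div1D_ge0//.
  by case: v0 => [/andP[]//|]; apply: lt_trans.
- rewrite disj_set2E; apply/eqP; rewrite -subset0 => v [] /=.
  by rewrite !in_itv/= andbT => /andP[_]; rewrite leNgt => /negP.
congr (_ + _)%E; first by rewrite -integral_itv_bndo_bndc//; apply: measurable_powR_div1D => v /=; rewrite !in_itv/= andbT => /andP[].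
transitivity (\int[mu]_(v in `]0%R, 1%R[)
    ((fun v => v `^ (x - 1) / (1 + v)) v^-1 * (v^-1 * v^-1))%:E)%E.
  apply: (@ge0_integration_by_substitution_decr R _ _ _ _ (fun v : R => v^-1) (fun v => v^-1 * v^-1)
   (fun v => v `^ (x - 1) / (1 + v)) (exhausted_oo ltr01)).
  - by move=> v; rewrite /= !in_itv/= andbT => /andP[v0 v1]; rewrite invf_gt1.
  - move=> y; rewrite /= in_itv/= andbT => y1; have y0 : 0 < y by exact: lt_trans y1.
    by exists y^-1; rewrite ?invrK// /= in_itv/= invr_gt0 y0 invf_lt1.
  - exact: interval_is_interval.
  - move=> v; rewrite /= in_itv/= => /andP[v0 _].
    have vn0 : v != 0 by rewrite gt_eqF.
    have h := @is_deriveV R id v 1 1 vn0 (is_derive_id _ _).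
    by apply: is_derive_eq; rewrite /GRing.scale/=; field.
  - move=> v; rewrite /= in_itv/= => /andP[v0 _].
    by apply: cvgM; apply: cvgV; rewrite ?gt_eqF//; exact: cvg_id.
  - by move=> v; rewrite /= in_itv/= => /andP[v0 _]; rewrite mulr_gt0 ?invr_gt0.
  - move=> v; rewrite /= in_itv/= andbT => v1; apply: powR_continuous_div1D; exact: lt_trans v1.
  - move=> v; rewrite /= in_itv/= andbT => v1; apply: powR_div1D_ge0; exact: lt_trans v1.
apply: eq_integral => v; rewrite inE/= in_itv/= => /andP[v0 v1]; congr EFin.
have v10 : 0 < 1 + v by rewrite addr_gt0.
rewrite -powR_inv1 ?(ltW v0)// -powRrM.
rewrite (_ : 1 - x - 1 = -1 * (x - 1) + -1); last by ring.
rewrite powR_gt0D// powR_inv1 ?(ltW v0)//; field.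
by rewrite !gt_eqF.
Qed.

(** Because v^(y-1) + v^y = v^(y-1) (1 + v). With positivity this recursion is
all that is used about this integral: it produces the alternating series
of 1 / (y + n) with an explicit remainder. *)
Lemma emellin_div1D01_add1 (y : R) : 0 < y -> (emellin_div1D01 y + emellin_div1D01 (y + 1) = (y^-1)%:E)%E.
Proof.
move=> y0; have I := integral_powR y0 ltr01; rewrite powR1 mul1r in I; rewrite -I.
rewrite -ge0_integralD//=.
- apply: eq_integral => v; rewrite inE/= in_itv/= => /andP[v0 v1].
  rewrite -EFinD; congr EFin; rewrite addrK -mulrDl.
  have -> : v `^ y = v `^ (y - 1) * v by rewrite -[in LHS](subrK 1 y) (powR_gt0D _ 1 v0) powRr1 ?ltW.
  by field; rewrite gt_eqF// addr_gt0.
- by move=> v; rewrite in_itv/= => /andP[v0 _]; rewrite lee_fin powR_div1D_ge0.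
- by apply: measurable_powR_div1D => v /=; rewrite !in_itv/= andbT => /andP[].
- by move=> v; rewrite in_itv/= => /andP[v0 _]; rewrite lee_fin powR_div1D_ge0.
- by apply: measurable_powR_div1D => v /=; rewrite !in_itv/= andbT => /andP[].
Qed.

Lemma emellin_div1D01_ge0 (y : R) : (0 <= emellin_div1D01 y)%E.
Proof.
by apply: integral_ge0 => v /=; rewrite in_itv/= => /andP[v0 _]; rewrite lee_fin powR_div1D_ge0.
Qed.

Lemma emellin_div1D01_le (y : R) : 0 < y -> (emellin_div1D01 y <= (y^-1)%:E)%E.
Proof. by move=> y0; rewrite -emellin_div1D01_add1// leeDl// emellin_div1D01_ge0. Qed.

Lemma emellin_div1D01_fin_num (y : R) : 0 < y -> emellin_div1D01 y \is a fin_num.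
Proof.
move=> y0; rewrite ge0_fin_numE ?emellin_div1D01_ge0//.
by rewrite (le_lt_trans (emellin_div1D01_le y0))// ltry.
Qed.

Definition mellin_div1D01 (y : R) : R := fine (emellin_div1D01 y).

Lemma mellin_div1D01_add1 (y : R) : 0 < y -> mellin_div1D01 y + mellin_div1D01 (y + 1) = y^-1.
Proof.
move=> y0; have := emellin_div1D01_add1 y0.
rewrite -(fineK (emellin_div1D01_fin_num y0)) -(fineK (emellin_div1D01_fin_num (addr_gt0 y0 ltr01))).
by move=> [].
Qed.

Lemma mellin_div1D01_ge0 (y : R) : 0 <= mellin_div1D01 y. Proof. exact/fine_ge0/emellin_div1D01_ge0. Qed.

Lemma mellin_div1D01_le (y : R) : 0 < y -> mellin_div1D01 y <= y^-1.
Proof. by move=> y0; rewrite -(mellin_div1D01_add1 y0) lerDl mellin_div1D01_ge0. Qed.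

Lemma emellin_div1DE (x : R) : 0 < x < 1 -> (emellin_div1D x = (mellin_div1D01 x + mellin_div1D01 (1 - x))%:E)%E.
Proof.
move=> /andP[x0 x1].
by rewrite emellin_div1D_split EFinD !fineK// emellin_div1D01_fin_num// subr_gt0.
Qed.

(** Substitute v = t / (1 - t). *)
Lemma integral_beta_onem (x : R) :
  (\int[mu]_(t in `]0%R, 1%R[) (t `^ (x - 1) * (1 - t) `^ (- x))%:E = emellin_div1D x)%E.
Proof.
rewrite /emellin_div1D.
transitivity (\int[mu]_(t in `]0%R, 1%R[)
    ((fun v => v `^ (x - 1) / (1 + v)) (t / (1 - t)) * ((1 - t)^-1 * (1 - t)^-1))%:E)%E; last first.
  apply/esym.
  apply: (@ge0_integration_by_substitution_incr R _ _ _ _ (fun t : R => t / (1 - t))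
    (fun t => (1 - t)^-1 * (1 - t)^-1) (fun v => v `^ (x - 1) / (1 + v)) (exhausted_oo ltr01)).
  - by move=> t; rewrite /= !in_itv/= andbT => /andP[t0 t1]; rewrite divr_gt0 ?subr_gt0.
  - move=> y; rewrite /= in_itv/= andbT => y0; have y1 : 0 < 1 + y by rewrite addr_gt0.
    exists (y / (1 + y)).
      by rewrite /= in_itv/= divr_gt0//= ltr_pdivrMr// mul1r ltrDr.
    by field; rewrite addrK oner_neq0/= gt_eqF.
  - exact: interval_is_interval.
  - move=> t; rewrite /= in_itv/= => /andP[t0 t1].
    have tn0 : 1 - t != 0 by rewrite gt_eqF// subr_gt0.
    have h1 : is_derive t 1 (fun t : R => 1 - t) (-1).
      by apply: is_derive_eq; rewrite add0r mul1r.
    have h := @is_deriveV R (fun t : R => 1 - t) t _ 1 tn0 h1.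
    by apply: is_derive_eq; rewrite /GRing.scale/=; field.
  - move=> t; rewrite /= in_itv/= => /andP[t0 t1].
    have tn0 : 1 - t != 0 by rewrite gt_eqF// subr_gt0.
    by apply: cvgM; apply: cvgV => //; apply: cvgB; [exact: cvg_cst|exact: cvg_id|exact: cvg_cst|exact: cvg_id].
  - by move=> t; rewrite /= in_itv/= => /andP[t0 t1]; rewrite mulr_gt0 ?invr_gt0// subr_gt0.
  - move=> v; rewrite /= in_itv/= andbT => v0; exact: powR_continuous_div1D.
  - move=> v; rewrite /= in_itv/= andbT => v0; exact: powR_div1D_ge0.
apply: eq_integral => t; rewrite inE/= in_itv/= => /andP[t0 t1]; congr EFin.
have t10 : 0 < 1 - t by rewrite subr_gt0.
rewrite powRM ?invr_ge0 ?(ltW t0) ?(ltW t10)// -(powR_inv1 (ltW t10)) -powRrM.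
rewrite (_ : - x = -1 * (x - 1) + -1); last by ring.
rewrite (powR_gt0D _ _ t10) (powR_inv1 (ltW t10)); field.
by rewrite subrK oner_neq0 gt_eqF.
Qed.

(** Substitute v = u^2 / K^2. *)
Lemma integral_powR_sqrD (p K : R) : 0 < K ->
  (\int[mu]_(u in `]0%R, +oo[) (u `^ p / (u ^+ 2 + K ^+ 2))%:E =
    (K `^ (p - 1) / 2)%:E * emellin_div1D ((p + 1) / 2))%E.
Proof.
move=> K0.
have -> : emellin_div1D ((p + 1) / 2) = (\int[mu]_(u in `]0%R, +oo[)
    ((fun v => v `^ ((p + 1) / 2 - 1) / (1 + v)) (u ^+ 2 / K ^+ 2) * (2 * u / K ^+ 2))%:E)%E.
  apply: (@ge0_integration_by_substitution_incr R _ _ _ _ (fun u : R => u ^+ 2 / K ^+ 2)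
    (fun u => 2 * u / K ^+ 2) (fun v => v `^ ((p + 1) / 2 - 1) / (1 + v)) exhausted_oy).
  - by move=> u; rewrite /= !in_itv/= !andbT => u0; rewrite divr_gt0 ?exprn_gt0.
  - move=> y; rewrite /= in_itv/= andbT => y0.
    exists (K * Num.sqrt y); first by rewrite /= in_itv/= andbT mulr_gt0 ?sqrtr_gt0.
    by rewrite exprMn sqr_sqrtr ?ltW//; field; rewrite gt_eqF.
  - exact: interval_is_interval.
  - move=> u _; apply: is_derive_eq; rewrite /GRing.scale/=; field.
    by rewrite gt_eqF.
  - move=> u _; apply: cvgM; last exact: cvg_cst.
    by apply: cvgM; [exact: cvg_cst|exact: cvg_id].
  - by move=> u; rewrite /= in_itv/= andbT => u0; rewrite divr_gt0 ?exprn_gt0 ?mulr_gt0.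
  - move=> v; rewrite /= in_itv/= andbT => v0; exact: powR_continuous_div1D.
  - move=> v; rewrite /= in_itv/= andbT => v0; exact: powR_div1D_ge0.
rewrite -ge0_integralZl_EFin//=.
- apply: eq_integral => u; rewrite inE/= in_itv/= andbT => u0.
  rewrite -EFinM; congr EFin.
  have -> : (u ^+ 2 / K ^+ 2) `^ ((p + 1) / 2 - 1) = u `^ p / u * (K / K `^ p).
    have -> : u ^+ 2 / K ^+ 2 = (u / K) `^ 2.
      by rewrite powR_mulrn ?divr_ge0 ?ltW// exprMn exprVn.
    rewrite -powRrM (_ : 2 * ((p + 1) / 2 - 1) = p - 1); last by field.
    rewrite powRM ?invr_ge0 ?ltW// (powR_gt0D _ _ u0) powR_inv1 ?ltW//; congr (_ * _).
    rewrite -(powR_inv1 (ltW K0)) -powRrM (_ : -1 * (p - 1) = 1 + - p); last by ring.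
    by rewrite (powR_gt0D _ _ K0) powRr1 ?ltW// powRN.
  rewrite (powR_gt0D _ _ K0) powR_inv1 ?(ltW K0)//; field.
  rewrite !gt_eqF ?powR_gt0//= ?addr_gt0 ?exprn_gt0//.
- move=> u; rewrite in_itv/= andbT => u0; rewrite lee_fin mulr_ge0//.
    by rewrite powR_div1D_ge0// divr_gt0 ?exprn_gt0.
  by rewrite divr_ge0 ?exprn_ge0 ?mulr_ge0 ?ltW.
- apply: measurable_continuous_pos => // u u0; apply: cvgM; last first.
    by apply: cvgM; [apply: cvgM; [exact: cvg_cst|exact: cvg_id]|exact: cvg_cst].
  apply: (@cvg_comp _ _ _ (fun u : R => u ^+ 2 / K ^+ 2) (fun v => v `^ ((p + 1) / 2 - 1) / (1 + v)));
    last by apply: powR_continuous_div1D; rewrite divr_gt0 ?exprn_gt0.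
  by apply: cvgM; [exact: exprn_continuous|exact: cvg_cst].
- by rewrite divr_ge0 ?powR_ge0.
Qed.
End mellin.

(** * Partial fractions of the cosecant by Fejer means *)

Section reflection.
Context {R : realType}.
Implicit Types x t : R.

Lemma sin_addNpi (n : nat) x : sin ((x + n%:R) * pi) = (-1) ^+ n * sin (x * pi).
Proof.
elim: n => [|n IH]; first by rewrite addr0 expr0 mul1r.
have -> : (x + n.+1%:R) * pi = (x + n%:R) * pi + pi by rewrite -natr1; ring.
by rewrite sinDpi IH exprS; ring.
Qed.

Lemma sin_subNpi (n : nat) x : sin ((x - n%:R) * pi) = (-1) ^+ n * sin (x * pi).
Proof.
rewrite -{2}(subrK n%:R x) sin_addNpi mulrA -exprMn.
by rewrite mulrNN mul1r expr1n mul1r.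
Qed.

Lemma sin_natr_pi (n : nat) : sin (n%:R * pi) = 0 :> R.
Proof. by rewrite -[n%:R]add0r sin_addNpi mul0r sin0 mulr0. Qed.

Definition dirichlet (M : nat) t : R := 1 + \sum_(i < M) 2 * cos (i.+1%:R * t).

(** N times the classical Fejer kernel. *)
Definition fejer (N : nat) t : R := \sum_(M < N) dirichlet M t.

Lemma one_sub_cos_dirichlet M t : (1 - cos t) * dirichlet M t = cos (M%:R * t) - cos (M.+1%:R * t).
Proof.
elim: M => [|M IH]; first by rewrite /dirichlet big_ord0 addr0 mulr1 mul0r cos0 mul1r.
rewrite /dirichlet big_ord_recr/= addrA mulrDr -/(dirichlet M t) IH.
have -> : M.+2%:R * t = M.+1%:R * t + t by rewrite -natr1; ring.
have -> : M%:R * t = M.+1%:R * t - t by rewrite -natr1; ring.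
by rewrite cosB cosD; ring.
Qed.

(** The products with the Dirichlet kernels telescope; this is the closed form
of the Fejer kernel cleared of its denominator. *)
Lemma one_sub_cos_fejer N t : (1 - cos t) * fejer N t = 1 - cos (N%:R * t).
Proof.
elim: N => [|N IH]; first by rewrite /fejer big_ord0 mulr0 mul0r cos0 subrr.
by rewrite /fejer big_ord_recr/= mulrDr -/(fejer N t) IH one_sub_cos_dirichlet; ring.
Qed.

(** As 0 < x < 1, 1 - cos (x t) <= 1 - cos t on [0, pi]: the factor in front
of the kernel absorbs its denominator, and the bound is uniform in N. *)
Lemma fejer_bound N x t : 0 < x < 1 -> 0 < t < pi ->
  0 <= (1 - cos (x * t)) * fejer N t <= 2.
Proof.
move=> /andP[x0 x1] /andP[t0 tpi].
have c1 : cos t < 1.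
  by rewrite -cos0 ltr_cos// in_itv/= ?lexx ?pi_ge0// !ltW.
have F0 : 0 <= fejer N t.
  rewrite -(pmulr_rge0 _ (_ : 0 < 1 - cos t)) ?subr_gt0// one_sub_cos_fejer.
  by rewrite subr_ge0 cos_le1.
have cx : cos t <= cos (x * t).
  have xt : x * t < t by rewrite gtr_pMl.
  apply: ltW; rewrite ltr_cos// in_itv/= ?(ltW t0) ?(ltW tpi)//.
  by rewrite mulr_ge0 ?ltW// (lt_trans xt).
apply/andP; split; first by rewrite mulr_ge0// subr_ge0 cos_le1.
apply: (@le_trans _ _ ((1 - cos t) * fejer N t)).
  by rewrite ler_wpM2r// lerB.
rewrite one_sub_cos_fejer; have := cos_geN1 (N%:R * t); lra.
Qed.

(** The symmetric partial sum, over indices of absolute value at most M, of the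
partial-fraction expansion of pi / sin (pi x). *)
Definition csc_partial_sum (M : nat) x : R :=
  x^-1 + \sum_(i < M) (-1) ^+ i.+1 * ((x + i.+1%:R)^-1 + (x - i.+1%:R)^-1).

(** The primitive, vanishing at 0, of (1 - cos (x t)) times the Dirichlet
kernel: expanding the products of cosines gives the frequencies x + n and
x - n, hence the partial fractions in the value at pi. *)
Definition dirichlet_primitive (x : R) (M : nat) t : R := t - sin (x * t) / x +
  \sum_(i < M) (2 * (sin (i.+1%:R * t) / i.+1%:R) - sin ((x + i.+1%:R) * t) / (x + i.+1%:R)
    - sin ((x - i.+1%:R) * t) / (x - i.+1%:R)).

Lemma is_derive_sinM (c t : R) : c != 0 -> is_derive t 1 (fun t => sin (c * t) / c) (cos (c * t)).
Proof.
move=> c0; apply: is_derive_eq; rewrite /GRing.scale/=; field; exact: c0.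
Qed.

Lemma is_derive_dirichlet_primitive x M t : 0 < x < 1 ->
  is_derive t 1 (dirichlet_primitive x M) ((1 - cos (x * t)) * dirichlet M t).
Proof.
move=> /andP[x0 x1].
elim: M => [|M IH].
  have d := is_derive_sinM t (lt0r_neq0 x0).
  rewrite /dirichlet_primitive /dirichlet.
  under eq_fun do rewrite big_ord0 addr0.
  by rewrite big_ord0 addr0 mulr1; apply: is_derive_eq.
rewrite /dirichlet_primitive; under eq_fun do rewrite big_ord_recr/= addrA.
have d1 : is_derive t 1 (fun t => sin (M.+1%:R * t) / M.+1%:R) (cos (M.+1%:R * t)).
  by apply: is_derive_sinM.
have d2 : is_derive t 1 (fun t => sin ((x + M.+1%:R) * t) / (x + M.+1%:R)) (cos ((x + M.+1%:R) * t)).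
  by apply: is_derive_sinM; rewrite gt_eqF// addr_gt0.
have d3 : is_derive t 1 (fun t => sin ((x - M.+1%:R) * t) / (x - M.+1%:R)) (cos ((x - M.+1%:R) * t)).
  apply: is_derive_sinM; rewrite subr_eq0 lt_eqF// (lt_le_trans x1)//.
  by rewrite ler1n.
have := @is_deriveD _ _ _ _ _ _ _ _ _ IH (is_deriveB (is_deriveB (is_deriveZ 2 d1) d2) d3) => d.
apply: is_derive_eq.
rewrite /GRing.scale/= /dirichlet big_ord_recr/= (mulrDl x) (mulrBl t x) cosB cosD.
ring.
Qed.

Lemma dirichlet_primitive_pi x M : dirichlet_primitive x M pi = pi - sin (x * pi) * csc_partial_sum M x.
Proof.
rewrite /dirichlet_primitive /csc_partial_sum (mulrDr (sin (x * pi))) opprD addrA mulr_sumr -sumrN; congr (_ + _).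
apply: eq_bigr => i _.
by rewrite sin_addNpi sin_subNpi sin_natr_pi; ring.
Qed.

Lemma dirichlet_primitive0 x M : dirichlet_primitive x M 0 = 0.
Proof.
rewrite /dirichlet_primitive mulr0 sin0 mul0r subrr add0r big1// => i _.
by rewrite !mulr0 sin0 !mul0r mulr0 !subr0.
Qed.

(** By the mean value theorem the sum is pi times the value of
(1 - cos (x t)) [fejer N t] at some point, which [fejer_bound] controls. *)
Lemma fejer_mean_bound x N : 0 < x < 1 ->
  0 <= \sum_(M < N) (pi - sin (x * pi) * csc_partial_sum M x) <= 2 * pi.
Proof.
move=> x01.
pose P t : R := \sum_(M < N) dirichlet_primitive x M t.
have dP t : is_derive t 1 P ((1 - cos (x * t)) * fejer N t).
  rewrite /P /fejer mulr_sumr.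
  have := @is_derive_sum _ _ _ N (fun M => dirichlet_primitive x M) t 1 _ (fun M => is_derive_dirichlet_primitive M t x01).
  by rewrite (_ : \sum_(i < N) _ = P)//; apply/funext => s; rewrite fct_sumE.
have [|c cpi E] := @MVT _ P _ 0 pi (pi_gt0 R) (fun t _ => dP t).
  by apply: continuous_subspaceT => t; apply: is_derive_continuous; exact: dP.
have <- : P pi - P 0 = \sum_(M < N) (pi - sin (x * pi) * csc_partial_sum M x).
  rewrite /P [X in _ - X]big1; last by move=> i _; rewrite dirichlet_primitive0.
  by rewrite subr0; apply: eq_bigr => i _; rewrite dirichlet_primitive_pi.
rewrite E subr0; move: cpi; rewrite in_itv/= => cpi.
have /andP[h1 h2] := fejer_bound N x01 cpi.
by rewrite mulr_ge0 ?pi_ge0//= ler_wpM2r// pi_ge0.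
Qed.

(** Induction on M, each step applying [mellin_div1D01_add1] at the two new
poles. *)
Lemma csc_partial_sumE M x : 0 < x < 1 ->
  csc_partial_sum M x = mellin_div1D01 x + mellin_div1D01 (1 - x) + (-1) ^+ M * (mellin_div1D01 (x + M.+1%:R) - mellin_div1D01 (1 - x + M%:R)).
Proof.
move=> /andP[x0 x1].
elim: M => [|M IH].
  by rewrite /csc_partial_sum big_ord0 addr0 addr0 expr0 -(mellin_div1D01_add1 x0); ring.
rewrite /csc_partial_sum big_ord_recr/= addrA -/(csc_partial_sum M x) IH.
have h1 : 0 < x + M.+1%:R by rewrite addr_gt0.
have h2 : 0 < 1 - x + M%:R by rewrite ltr_wpDr// subr_gt0.
have <- := mellin_div1D01_add1 h1.
have -> : (x - M.+1%:R)^-1 = - (1 - x + M%:R)^-1 by rewrite -invrN; congr (_^-1); rewrite -natr1; ring.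
rewrite -(mellin_div1D01_add1 h2) exprS.
rewrite -(natr1 M.+1) -(natr1 M) !addrA; ring.
Qed.

(** Both remainders of [csc_partial_sumE] lie between 0 and 1 / (1 - x + M),
which is at most (1 - x)^-1 / (M + 1). *)
Lemma csc_partial_sum_cvg x : 0 < x < 1 -> csc_partial_sum M x @[M --> \oo] --> mellin_div1D01 x + mellin_div1D01 (1 - x).
Proof.
move=> x01; have /andP[x0 x1] := x01.
have y0 : 0 < 1 - x by rewrite subr_gt0.
apply/subr_cvg0; apply/norm_cvg0P.
apply: (@squeeze_cvgr _ _ _ _ (fun=> 0) (fun n => (1 - x)^-1 * harmonic n)).
- near=> n; rewrite normr_ge0/= csc_partial_sumE//.
  rewrite addrAC subrr add0r normrM normrX normrN1 expr1n mul1r.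
  have a0 : 0 < 1 - x + n%:R by rewrite ltr_wpDr.
  apply: (@le_trans _ _ (1 - x + n%:R)^-1).
    rewrite ler_norml; apply/andP; split.
      rewrite lerNl opprB; apply: le_trans (mellin_div1D01_le a0).
      by rewrite lerBlDr lerDl mellin_div1D01_ge0.
    rewrite lerBlDr (@le_trans _ _ (1 - x + n%:R)^-1)// ?lerDl ?mellin_div1D01_ge0//.
    apply: le_trans (mellin_div1D01_le _) _; first by rewrite addr_gt0.
    have b0 : 0 < x + n.+1%:R by rewrite addr_gt0.
    rewrite lef_pV2// -natr1; lra.
  rewrite /harmonic -invfM lef_pV2 ?posrE ?mulr_gt0// -natr1.
  by rewrite mulrDr mulr1 addrC lerD2l ler_piMl// lerBlDr lerDl ltW.
- exact: cvg_cst.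
- rewrite -[X in _ --> X](mulr0 (1 - x)^-1); apply: cvgM; first exact: cvg_cst.
  exact: cvg_harmonic.
Unshelve. all: by end_near. Qed.

(** The Cesaro means of pi - sin (pi x) (partial sum) tend to 0 by
[fejer_mean_bound] and to pi - sin (pi x) (limit) by [csc_partial_sum_cvg]. *)
Lemma mellin_div1D01_reflection x : 0 < x < 1 -> mellin_div1D01 x + mellin_div1D01 (1 - x) = pi / sin (pi * x).
Proof.
move=> x01; have /andP[x0 x1] := x01.
have s0 : 0 < sin (pi * x).
  by rewrite sin_gt0_pi// mulr_gt0 ?pi_gt0//= gtr_pMr ?pi_gt0.
pose u M := pi - sin (x * pi) * csc_partial_sum M x.
have /cesaro uc : u M @[M --> \oo] --> pi - sin (x * pi) * (mellin_div1D01 x + mellin_div1D01 (1 - x)).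
  apply: cvgB; first exact: cvg_cst.
  apply: cvgM; first exact: cvg_cst.
  exact: csc_partial_sum_cvg.
have u0 : arithmetic_mean u @ \oo --> 0.
  apply: (@squeeze_cvgr _ _ _ _ (fun=> 0) (fun n => 2 * pi * harmonic n)).
  - near=> n; rewrite /arithmetic_mean/= /series/= big_mkord.
    have /andP[h1 h2] := fejer_mean_bound n.+1 x01.
    by rewrite mulr_ge0//= mulrC /harmonic ler_wpM2r.
  - exact: cvg_cst.
  - rewrite -[X in _ --> X](mulr0 (2 * pi)); apply: cvgM; first exact: cvg_cst.
    exact: cvg_harmonic.
have sn0 : sin (pi * x) != 0 by rewrite gt_eqF.
have E0 : pi - sin (x * pi) * (mellin_div1D01 x + mellin_div1D01 (1 - x)) = 0 by apply: (cvg_unique _ uc u0).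
have /eqP := E0; rewrite subr_eq0 (mulrC x) => /eqP E.
by apply/(canRL (mulfK sn0)); rewrite mulrC -E.
Unshelve. all: by end_near. Qed.

End reflection.

(** * Euler reflection and the ratio of the constants *)

Section gamma_reflection.
Context {R : realType}.
Notation mu := (@lebesgue_measure R).
Implicit Types a x H : R.

Lemma emellin_div1D_reflection x : 0 < x < 1 -> emellin_div1D x = (pi / sin (pi * x))%:E.
Proof. by move=> x01; rewrite emellin_div1DE// mellin_div1D01_reflection. Qed.

(** Because 1 + t <= exp t. It yields the finiteness of Gamma on ]0, 1[. *)
Lemma eGamma_le_emellin_div1D x : (eGamma x <= emellin_div1D x)%E.
Proof.
apply: ge0_le_integral => //=.
- by move=> t; rewrite in_itv/= andbT => t0; rewrite lee_fin mulr_ge0 ?powR_ge0 ?expR_ge0.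
- apply/measurable_EFinP; apply: measurable_funTS; apply: measurable_funM.
    exact: measurable_powR_fun.
  exact: measurableT_comp.
- exact: measurable_powR_div1D.
- move=> t; rewrite in_itv/= andbT => t0; rewrite lee_fin ler_wpM2l ?powR_ge0//.
  rewrite expRN lef_pV2 ?posrE ?expR_gt0 ?addr_gt0//.
  exact: expR_ge1Dx.
Qed.

Lemma eGamma_fin_num x : 0 < x < 1 -> eGamma x \is a fin_num.
Proof.
move=> x01; rewrite ge0_fin_numE ?eGamma_ge0//.
by apply: le_lt_trans (eGamma_le_emellin_div1D x) _; rewrite emellin_div1D_reflection// ltry.
Qed.

Lemma Gamma_reflection x : 0 < x < 1 -> Gamma x * Gamma (1 - x) = pi / sin (pi * x).
Proof.
move=> x01; have y01 : 0 < 1 - x < 1 by apply/andP; split; lra.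
have := eGamma_mul_onem x; rewrite emellin_div1D_reflection//.
rewrite -(fineK (eGamma_fin_num x01)) -(fineK (eGamma_fin_num y01)).
by move=> [].
Qed.

Lemma sin_pi_gt0 x : 0 < x < 1 -> 0 < sin (pi * x).
Proof.
move=> /andP[x0 x1]; rewrite sin_gt0_pi// mulr_gt0 ?pi_gt0//= gtr_pMr ?pi_gt0//.
Qed.

Lemma Gamma_gt0 x : 0 < x < 1 -> 0 < Gamma x.
Proof.
move=> x01; rewrite lt_neqAle GammaE fine_ge0 ?eGamma_ge0// andbT.
apply/eqP => x0; have := Gamma_reflection x01.
rewrite GammaE -x0 mul0r => /eqP; rewrite eq_sym mulf_eq0 gt_eqF ?pi_gt0//= invr_eq0.
by rewrite gt_eqF// sin_pi_gt0.
Qed.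

Lemma Gamma_add1 x : 0 < x -> Gamma (x + 1) = x * Gamma x.
Proof.
move=> x0; rewrite !GammaE eGamma_add1//; have := eGamma_ge0 x.
case: (eGamma x) => [r _//|_|//].
by rewrite gt0_muley ?lte_fin// mulr0.
Qed.

Lemma BetaE x : 0 < x < 1 -> Beta x (1 - x) = pi / sin (pi * x).
Proof.
move=> x01; rewrite /Beta /Rintegral (_ : 1 - x - 1 = - x); last by ring.
by rewrite integral_beta_onem emellin_div1D_reflection.
Qed.

(** With x = H - 1/2, the Beta factor is pi / sin (pi x), the product
Gamma (2x) Gamma (1 - 2x) is pi / sin (2 pi x), and sin (pi H) = cos (pi x):
the identity is the double-angle formula. *)
Lemma b_zero_div_a_zero H : 1 / 2 < H -> H < 1 ->
  b_zero H / a_zero H = Gamma (2 * H + 1) * sin (pi * H).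
Proof.
move=> H1 H2; pose x := H - 1 / 2.
have x01 : 0 < x < 1 by apply/andP; split; rewrite /x; lra.
have a01 : 0 < x *+ 2 < 1 by rewrite mulr2n; apply/andP; split; rewrite /x; lra.
have [a0 a1] := andP a01.
rewrite /b_zero /a_zero.
rewrite (_ : 3 / 2 - H = 1 - x); last by rewrite /x; lra.
rewrite BetaE//.
have -> : 2 * H + 1 = x *+ 2 + 1 + 1 by rewrite /x mulr2n; field.
have -> : 2 - 2 * H = 1 - x *+ 2 by rewrite /x mulr2n; field.
have -> : pi * H = pi * x + pi / 2 by rewrite /x; field.
rewrite sinDpihalf !Gamma_add1 ?(addr_gt0 a0)//.
have := Gamma_reflection a01.
rewrite mulrnAr sin_mulr2n.
have sx := lt0r_neq0 (sin_pi_gt0 x01).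
have := sin_pi_gt0 a01; rewrite mulrnAr sin_mulr2n => s2.
have cx : cos (pi * x) != 0 by apply/eqP => c0; move: s2; rewrite c0 mul0r mul0rn ltxx.
have b01 : 0 < 1 - x *+ 2 < 1 by apply/andP; split; lra.
have G1 := lt0r_neq0 (Gamma_gt0 b01).
have pi0 : pi != 0 :> R by rewrite gt_eqF ?pi_gt0.
move=> E; have -> : Gamma (x *+ 2) = pi / (cos (pi * x) * sin (pi * x) *+ 2) / Gamma (1 - x *+ 2).
  by rewrite -E mulfK.
have HE : H = x + 1 / 2 by rewrite /x subrK.
rewrite -/x HE; clearbody x; clear HE.
move: sx cx G1 pi0 x01; set s := sin _; set c := cos _; set g := Gamma _; set q := pi.
clearbody s c g q; move=> sn cn gn qn /andP[x0 _]; rewrite !mulr2n; field.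
have h2 : c * s + c * s != 0 by rewrite -mulr2n mulrn_eq0/= mulf_neq0.
have h3 : x * 2 + 1 - 1 != 0 by rewrite addrK gt_eqF// mulr_gt0.
by rewrite gn h2 sn h3.
Qed.

End gamma_reflection.

(** * Laplace transforms of the sine and the cosine on the unit interval *)

Section oscillatory.
Context {R : realType}.
Notation mu := (@lebesgue_measure R).
Implicit Types (a p u K s : R) (g h L : R -> R).

(** Gamma (1 - a) t^(a-1) is the Laplace transform of u^(-a) at t; exchange the
two integrals. *)
Lemma laplace_tonelli a h L :
  measurable_fun setT h -> (forall t, 0 < t <= 1 -> 0 <= h t) ->
  (forall u, 0 < u ->
     (\int[mu]_(t in `]0%R, 1%R]) (expR (- (t * u)) * h t)%:E = (L u)%:E)%E) ->
  (eGamma (1 - a) * \int[mu]_(t in `]0%R, 1%R]) (t `^ (a - 1) * h t)%:E =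
   \int[mu]_(u in `]0%R, +oo[) (u `^ (- a) * L u)%:E)%E.
Proof.
move=> mh h0 hL.
rewrite -ge0_integralZl//=; last 3 first.
- apply/measurable_EFinP; apply: measurable_funTS; apply: measurable_funM.
    exact: measurable_powR_fun.
  exact: mh.
- by move=> t; rewrite in_itv/= => t01; rewrite lee_fin mulr_ge0 ?powR_ge0 ?h0.
- exact: eGamma_ge0.
under eq_integral.
  move=> t; rewrite inE/= in_itv/= => t01; have /andP[t0 t1] := t01.
  rewrite EFinM muleA [X in (X * _)%E]muleC (_ : a - 1 = - (1 - a)); last by ring.
  rewrite -eGamma_scale// muleC -ge0_integralZl_EFin ?h0//=; last 2 first.
    by move=> u _; rewrite lee_fin mulr_ge0 ?powR_ge0 ?expR_ge0.
    apply/measurable_EFinP; apply: measurable_funTS; apply: measurable_funM; first exact: measurable_powR_fun.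
    by apply: measurableT_comp => //; apply: measurableT_comp => //; exact: measurable_funM.
  rewrite (_ : 1 - a - 1 = - a); last by ring.
  under eq_integral do rewrite -EFinM.
  over.
rewrite (@ge0_tonelli R _ _ (fun t u => h t * (u `^ (- a) * expR (- (t * u)))))//=; last 2 first.
- apply: measurable_funM; first exact: measurable_fst_comp.
  apply: measurable_funM; last exact: measurable_expR_prod.
  exact: (measurable_snd_comp (measurable_powR_fun (- a))).
- by move=> t u; rewrite !in_itv/= => t01 _; rewrite !mulr_ge0 ?powR_ge0 ?expR_ge0 ?h0.
apply: eq_integral => u; rewrite inE/= in_itv/= andbT => u0.
under eq_integral do rewrite mulrCA (mulrC (h _)) EFinM.
rewrite ge0_integralZl_EFin ?powR_ge0//=.
- by rewrite hL.
- by move=> t; rewrite in_itv/= => t01; rewrite lee_fin mulr_ge0 ?expR_ge0 ?h0.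
- apply/measurable_EFinP; apply: measurable_funTS; apply: measurable_funM => //.
  by apply: measurableT_comp => //; apply: measurableT_comp => //; exact: measurable_funM.
Qed.

Lemma integral_oc_FTC (f F : R -> R) (r : R) : F 1 - F 0 = r ->
  (forall t : R, is_derive t 1 F (f t)) -> continuous f ->
  (\int[mu]_(t in `]0%R, 1%R]) (f t)%:E = r%:E)%E.
Proof.
move=> <- dF cf.
rewrite integral_itv_obnd_cbnd; last first.
  by apply/measurable_EFinP; apply: measurable_funTS; exact: continuous_measurable_fun.
rewrite (@continuous_FTC2 _ f F)//.
- exact: continuous_subspaceT.
- exact: (@derivable_oo_LRcontinuous_is_derive _ _ f).
- by move=> t _; rewrite derive1E; apply: derive_val; exact: dF.
Qed.

Lemma sqrD_gt0 u K : 0 < K -> 0 < u ^+ 2 + K ^+ 2.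
Proof. by move=> K0; rewrite ltr_wpDl ?sqr_ge0// exprn_gt0. Qed.

Lemma is_derive_expM (c t : R) : is_derive t 1 (fun t : R => expR (- (t * c))) (- c * expR (- (t * c))).
Proof. by apply: is_derive_eq; rewrite /GRing.scale/= mulr1; ring. Qed.

Lemma is_derive_sinK (c t : R) : is_derive t 1 (fun t : R => sin (c * t)) (c * cos (c * t)).
Proof. by apply: is_derive_eq; rewrite /GRing.scale/= mulr1; ring. Qed.

Lemma is_derive_cosK (c t : R) : is_derive t 1 (fun t : R => cos (c * t)) (- c * sin (c * t)).
Proof. by apply: is_derive_eq; rewrite /GRing.scale/= mulr1; ring. Qed.

Definition laplace1 u : R := (1 - expR (- u)) / u.

(** With sin K = 0 and cos K = s, the Laplace transforms of cos (K t) and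
sin (K t) on [0, 1] are u and K times this function. *)
Definition laplace_osc K s u : R := (1 - s * expR (- u)) / (u ^+ 2 + K ^+ 2).

Lemma continuous_expM (c : R) : continuous (fun t : R => expR (- (t * c))).
Proof. move=> t; exact: is_derive_continuous (is_derive_expM c t). Qed.

Lemma continuous_sinK (c : R) : continuous (fun t : R => sin (c * t)).
Proof. move=> t; exact: is_derive_continuous (is_derive_sinK c t). Qed.

Lemma continuous_cosK (c : R) : continuous (fun t : R => cos (c * t)).
Proof. move=> t; exact: is_derive_continuous (is_derive_cosK c t). Qed.

Lemma integral_laplace1 u : 0 < u ->
  (\int[mu]_(t in `]0%R, 1%R]) (expR (- (t * u)))%:E = (laplace1 u)%:E)%E.
Proof.
move=> u0.
apply: (@integral_oc_FTC _ (fun t => - (expR (- (t * u)) / u)) _).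
- by rewrite mul0r mul1r oppr0 expR0 /laplace1; field; rewrite gt_eqF.
- move=> t; have d := is_derive_expM u t.
  by apply: is_derive_eq; rewrite /GRing.scale/=; field; rewrite gt_eqF.
- exact: continuous_expM.
Qed.

Lemma integral_laplace_cos K s u : sin K = 0 -> cos K = s -> 0 < K -> 0 < u ->
  (\int[mu]_(t in `]0%R, 1%R]) (expR (- (t * u)) * (1 + cos (K * t)))%:E =
   (laplace1 u + u * laplace_osc K s u)%:E)%E.
Proof.
move=> sK cK K0 u0; have n0 := lt0r_neq0 (sqrD_gt0 u K0).
apply: (@integral_oc_FTC _ (fun t => - (expR (- (t * u)) / u) +
   expR (- (t * u)) * (K * sin (K * t) - u * cos (K * t)) / (u ^+ 2 + K ^+ 2)) _).
- rewrite !mulr1 mul0r mul1r mulr0 oppr0 expR0 sin0 cos0 sK cK /laplace1 /laplace_osc.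
  by field; rewrite n0 gt_eqF.
- move=> t; have d := is_derive_expM u t; have ds := is_derive_sinK K t; have dc := is_derive_cosK K t.
  by apply: is_derive_eq; rewrite /GRing.scale/=; field; rewrite n0 gt_eqF.
- move=> t; apply: cvgM; first exact: continuous_expM.
  by apply: cvgD; [exact: cvg_cst|exact: continuous_cosK].
Qed.

Lemma integral_laplace_sin K s u : sin K = 0 -> cos K = s -> 0 < K -> 0 < u ->
  (\int[mu]_(t in `]0%R, 1%R]) (expR (- (t * u)) * (1 + sin (K * t)))%:E =
   (laplace1 u + K * laplace_osc K s u)%:E)%E.
Proof.
move=> sK cK K0 u0; have n0 := lt0r_neq0 (sqrD_gt0 u K0).
apply: (@integral_oc_FTC _ (fun t => - (expR (- (t * u)) / u) +
   expR (- (t * u)) * (- u * sin (K * t) - K * cos (K * t)) / (u ^+ 2 + K ^+ 2)) _).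
- rewrite !mulr1 mul0r mul1r mulr0 oppr0 expR0 sin0 cos0 sK cK /laplace1 /laplace_osc.
  by field; rewrite n0 gt_eqF.
- move=> t; have d := is_derive_expM u t; have ds := is_derive_sinK K t; have dc := is_derive_cosK K t.
  by apply: is_derive_eq; rewrite /GRing.scale/=; field; rewrite n0 gt_eqF.
- move=> t; apply: cvgM; first exact: continuous_expM.
  by apply: cvgD; [exact: cvg_cst|exact: continuous_sinK].
Qed.

Lemma continuous_laplace1 u : 0 < u -> {for u, continuous laplace1}.
Proof.
move=> u0; apply: cvgM; last by apply: cvgV; [rewrite gt_eqF|exact: cvg_id].
apply: cvgB; first exact: cvg_cst.
apply: (@cvg_comp _ _ _ (fun u : R => - u) (@expR R)); last exact: continuous_expR.
exact: opp_continuous.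
Qed.

Lemma laplace1_ge0 u : 0 < u -> 0 <= laplace1 u.
Proof.
move=> u0; rewrite divr_ge0 ?(ltW u0)// subr_ge0 -expR0 ler_expR.
by rewrite oppr_le0 ltW.
Qed.

Lemma continuous_laplace_osc K s u : 0 < K -> {for u, continuous (laplace_osc K s)}.
Proof.
move=> K0; apply: cvgM.
  apply: cvgB; first exact: cvg_cst.
  apply: cvgM; first exact: cvg_cst.
  apply: (@cvg_comp _ _ _ (fun u : R => - u) (@expR R)); last exact: continuous_expR.
  exact: opp_continuous.
apply: cvgV; first by rewrite gt_eqF// sqrD_gt0.
by apply: cvgD; [exact: exprn_continuous|exact: cvg_cst].
Qed.

Lemma laplace_osc_ge0 K s u : 0 < K -> 0 < u -> `|s| <= 1 -> 0 <= laplace_osc K s u.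
Proof.
move=> K0 u0 s1; rewrite divr_ge0 ?(ltW (sqrD_gt0 u K0))// subr_ge0.
apply: le_trans (ler_norm _) _; rewrite normrM mulr_ile1// ger0_norm ?expR_ge0//.
by rewrite -expR0 ler_expR oppr_le0 ltW.
Qed.

End oscillatory.

(** * Oscillatory integrals as Laplace integrals *)

Section mellin_transform.
Context {R : realType}.
Notation mu := (@lebesgue_measure R).
Implicit Types (a p u K s : R) (g h L : R -> R).

Lemma integrable_powR_oc a : 0 < a ->
  mu.-integrable `]0, 1] (fun t => (t `^ (a - 1))%:E).
Proof.
move=> a0; have mp : measurable_fun (`]0%R, 1%R]%classic : set R) (fun t : R => (t `^ (a - 1))%:E).
  by apply/measurable_EFinP; apply: measurable_funTS; exact: measurable_powR_fun.
apply/integrableP; split => //.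
under eq_integral do rewrite /= ger0_norm ?powR_ge0//.
rewrite -integral_itv_bndo_bndc; last first.
  by apply/measurable_EFinP; apply: measurable_funTS; exact: measurable_powR_fun.
by rewrite integral_powR// ltry.
Qed.

Lemma integrable_powR_osc a g : 0 < a -> continuous g -> (forall t, `|g t| <= 1) ->
  mu.-integrable `]0, 1] (fun t => (t `^ (a - 1) * g t)%:E).
Proof.
move=> a0 cg g1.
apply: le_integrable (integrable_powR_oc a0) => //.
- apply/measurable_EFinP; apply: measurable_funTS; apply: measurable_funM.
    exact: measurable_powR_fun.
  exact: continuous_measurable_fun.
- move=> t _; rewrite /= lee_fin normrM ler_piMr//.
Qed.

(** [laplace_tonelli] for the nonnegative functions 1 + g and 1, subtracted; the
subtraction is licit because the integral of t^(a-1) is finite. *)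
Lemma mellin_laplace a g L : 0 < a < 1 -> continuous g -> (forall t, `|g t| <= 1) ->
  (forall u, 0 < u ->
     (\int[mu]_(t in `]0%R, 1%R]) (expR (- (t * u)) * (1 + g t))%:E =
      (laplace1 u + L u)%:E)%E) ->
  (forall u, 0 < u -> 0 <= L u) -> (forall u, 0 < u -> {for u, continuous L}) ->
  (\int[mu]_(u in `]0%R, +oo[) (u `^ (- a) * L u)%:E =
    (Gamma (1 - a) * \int[mu]_(t in `]0, 1]) (t `^ (a - 1) * g t))%:E)%E.
Proof.
move=> /andP[a0 a1] cg g1 hL L0 cL.
have b01 : 0 < 1 - a < 1 by apply/andP; split; lra.
have G := eGamma_fin_num b01.
have mg : measurable_fun setT g by exact: continuous_measurable_fun.
have E1 := @laplace_tonelli R a (cst 1) laplace1.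
have Eg := @laplace_tonelli R a (fun t => 1 + g t) (fun u => laplace1 u + L u).
have I1 := integrable_powR_oc a0; have Ig := integrable_powR_osc a0 cg g1.
have {}E1 : (eGamma (1 - a) * \int[mu]_(t in `]0%R, 1%R]) (t `^ (a - 1))%:E =
    \int[mu]_(u in `]0%R, +oo[) (u `^ (- a) * laplace1 u)%:E)%E.
  rewrite -E1//; last first.
    by move=> u u0; under eq_integral do rewrite /cst mulr1; exact: integral_laplace1.
  by congr (_ * _)%E; apply: eq_integral => t _; rewrite mulr1.
have {}Eg : (eGamma (1 - a) * (\int[mu]_(t in `]0%R, 1%R]) (t `^ (a - 1))%:E +
     \int[mu]_(t in `]0%R, 1%R]) (t `^ (a - 1) * g t)%:E) =
    \int[mu]_(u in `]0%R, +oo[) (u `^ (- a) * laplace1 u)%:E +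
    \int[mu]_(u in `]0%R, +oo[) (u `^ (- a) * L u)%:E)%E.
  rewrite -[RHS]ge0_integralD//=.
  - rewrite -[X in (_ * X)%E]integralD//=.
    transitivity (eGamma (1 - a) * \int[mu]_(t in `]0%R, 1%R]) (t `^ (a - 1) * (1 + g t))%:E)%E.
      by congr (_ * _)%E; apply: eq_integral => t _; rewrite -EFinD mulrDr mulr1.
    rewrite Eg//.
    + by apply: eq_integral => u _; rewrite -EFinD mulrDr.
    + exact: measurable_funD.
    + move=> t _; have := g1 t; rewrite ler_norml => /andP[]; lra.
  - by move=> u; rewrite in_itv/= andbT => u0; rewrite lee_fin mulr_ge0 ?powR_ge0 ?laplace1_ge0.
  - apply: measurable_continuous_pos => // u u0; apply: cvgM; first exact: powR_continuous.
    exact: continuous_laplace1.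
  - by move=> u; rewrite in_itv/= andbT => u0; rewrite lee_fin mulr_ge0 ?powR_ge0 ?L0.
  - apply: measurable_continuous_pos => // u u0; apply: cvgM; first exact: powR_continuous.
    exact: cL.
move: Eg; rewrite -E1 /Rintegral.
have F1 : (\int[mu]_(t in `]0%R, 1%R]) (t `^ (a - 1))%:E)%E \is a fin_num by exact: integrable_fin_num.
have Fg : (\int[mu]_(t in `]0%R, 1%R]) (t `^ (a - 1) * g t)%:E)%E \is a fin_num by exact: integrable_fin_num.
rewrite muleDr ?fin_num_adde_defr// => Eg.
set X := (eGamma _ * _)%E in Eg; have FX : X \is a fin_num by rewrite fin_numM.
rewrite -[LHS](addeK _ FX) (addeC _ X) -Eg (addeC X) addeK//.
by rewrite EFinM GammaE !fineK.
Qed.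

(** The integral of u^p / (u^2 + K^2) is known exactly from the reflection
formula, and |s| exp (- u) / (u^2 + K^2) <= exp (- u) / K^2 bounds the
difference of the integrands. *)
Lemma integral_laplace_osc p K s : 0 < K -> -1 < p < 1 -> `|s| <= 1 ->
  eGamma (p + 1) \is a fin_num ->
  exists2 z : R, (\int[mu]_(u in `]0%R, +oo[) (u `^ p * laplace_osc K s u)%:E = z%:E)%E &
    `| z - K `^ (p - 1) * (pi / (2 * sin (pi * ((p + 1) / 2)))) | <= Gamma (p + 1) / K ^+ 2.
Proof.
move=> K0 /andP[p1 p2] s1 Gfin.
have q01 : 0 < (p + 1) / 2 < 1 by apply/andP; split; lra.
pose M := (\int[mu]_(u in `]0%R, +oo[) (u `^ p / (u ^+ 2 + K ^+ 2))%:E)%E.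
pose Z := (\int[mu]_(u in `]0%R, +oo[) (u `^ p * laplace_osc K s u)%:E)%E.
pose E := (\int[mu]_(u in `]0%R, +oo[) (K ^- 2 * (u `^ p * expR (- u)))%:E)%E.
have ME : M = (K `^ (p - 1) * (pi / (2 * sin (pi * ((p + 1) / 2)))))%:E.
  rewrite /M integral_powR_sqrD// emellin_div1D_reflection// -EFinM; congr EFin.
  by field; rewrite gt_eqF// sin_pi_gt0.
have EE : E = (Gamma (p + 1) / K ^+ 2)%:E.
  rewrite /E; under eq_integral do rewrite EFinM.
  rewrite ge0_integralZl_EFin//=.
  - rewrite EFinM GammaE fineK// muleC /eGamma.
    by under eq_integral do rewrite -[X in _ `^ X](addrK 1 p).
  - by move=> u _; rewrite lee_fin mulr_ge0 ?powR_ge0 ?expR_ge0.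
  - apply/measurable_EFinP; apply: measurable_funTS; apply: measurable_funM.
      exact: measurable_powR_fun.
    exact: measurableT_comp.
  - by rewrite invr_ge0 exprn_ge0// ltW.
have c1 u : 0 < u -> {for u, continuous (fun u => u `^ p / (u ^+ 2 + K ^+ 2))}.
  move=> u0; apply: cvgM; first exact: powR_continuous.
  apply: cvgV; first by rewrite gt_eqF// sqrD_gt0.
  by apply: cvgD; [exact: exprn_continuous|exact: cvg_cst].
have c2 u : 0 < u -> {for u, continuous (fun u => u `^ p * laplace_osc K s u)}.
  by move=> u0; apply: cvgM; [exact: powR_continuous|exact: continuous_laplace_osc].
have c3 u : 0 < u -> {for u, continuous (fun u => K ^- 2 * (u `^ p * expR (- u)))}.
  move=> u0; apply: cvgM; first exact: cvg_cst.
  apply: cvgM; first exact: powR_continuous.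
  apply: (@cvg_comp _ _ _ (fun u : R => - u) (@expR R)); last exact: continuous_expR.
  exact: opp_continuous.
have p0 u : 0 < u -> 0 <= u `^ p / (u ^+ 2 + K ^+ 2).
  by move=> u0; rewrite divr_ge0 ?powR_ge0// ltW// sqrD_gt0.
have p3 u : 0 < u -> 0 <= K ^- 2 * (u `^ p * expR (- u)).
  by move=> u0; rewrite !mulr_ge0 ?powR_ge0 ?expR_ge0// invr_ge0 exprn_ge0// ltW.
have p4 u : 0 < u -> 0 <= u `^ p * laplace_osc K s u.
  by move=> u0; rewrite mulr_ge0 ?powR_ge0// laplace_osc_ge0.
have dif u : 0 < u -> `| u `^ p * laplace_osc K s u - u `^ p / (u ^+ 2 + K ^+ 2) | <=
    K ^- 2 * (u `^ p * expR (- u)).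
  move=> u0; have D0 := sqrD_gt0 u K0.
  rewrite (_ : _ - _ = - s * (u `^ p * expR (- u) * (u ^+ 2 + K ^+ 2)^-1)); last first.
    by rewrite /laplace_osc; field; rewrite gt_eqF.
  rewrite normrM normrN -[leRHS]mul1r ler_pM// ger0_norm; last first.
    by rewrite !mulr_ge0 ?powR_ge0 ?expR_ge0// invr_ge0 ltW.
  rewrite mulrC ler_wpM2r ?mulr_ge0 ?powR_ge0 ?expR_ge0//.
  by rewrite lef_pV2 ?posrE ?exprn_gt0// lerDr sqr_ge0.
have comp (f1 f2 f3 : R -> R) :
    (forall u, 0 < u -> {for u, continuous f1}) -> (forall u, 0 < u -> {for u, continuous f2}) ->
    (forall u, 0 < u -> {for u, continuous f3}) -> (forall u, 0 < u -> 0 <= f1 u) ->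
    (forall u, 0 < u -> 0 <= f2 u) -> (forall u, 0 < u -> 0 <= f3 u) ->
    (forall u, 0 < u -> f1 u <= f2 u + f3 u) ->
    (\int[mu]_(u in `]0%R, +oo[) (f1 u)%:E <= \int[mu]_(u in `]0%R, +oo[) (f2 u)%:E +
      \int[mu]_(u in `]0%R, +oo[) (f3 u)%:E)%E.
  move=> k1 k2 k3 g1 g2 g3 le.
  rewrite -ge0_integralD//=.
  - apply: ge0_le_integral => //=.
    + by move=> u; rewrite in_itv/= andbT => /g1; rewrite lee_fin.
    + exact: measurable_continuous_pos.
    + apply: emeasurable_funD; exact: measurable_continuous_pos.
    + by move=> u; rewrite in_itv/= andbT => u0; rewrite lee_fin le.
  - by move=> u; rewrite in_itv/= andbT => /g2; rewrite lee_fin.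
  - exact: measurable_continuous_pos.
  - by move=> u; rewrite in_itv/= andbT => /g3; rewrite lee_fin.
  - exact: measurable_continuous_pos.
have up : (Z <= M + E)%E.
  by apply: comp => // u u0; have := dif u u0; rewrite ler_norml => /andP[_]; lra.
have lo : (M <= Z + E)%E.
  by apply: comp => // u u0; have := dif u u0; rewrite ler_norml => /andP[+ _]; lra.
have Zfin : Z \is a fin_num.
  rewrite ge0_fin_numE; last by apply: integral_ge0 => u /=; rewrite in_itv/= andbT => u0; rewrite lee_fin p4.
  by apply: le_lt_trans up _; rewrite ME EE -EFinD ltry.
exists (fine Z); first by rewrite fineK.
move: up lo; rewrite -(fineK Zfin) ME EE -!EFinD !lee_fin => up lo.
by rewrite ler_norml; apply/andP; split; [rewrite lerNl opprB lerBlDl|rewrite lerBlDl].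
Qed.

End mellin_transform.

(** * Asymptotics of the oscillatory integrals *)

Section asymptotics.
Context {R : realType}.
Notation mu := (@lebesgue_measure R).
Implicit Types (a p u K s H : R).

Lemma cos_natr_pi (k : nat) : cos (k%:R * pi) = (-1) ^+ k :> R.
Proof.
elim: k => [|k IH]; first by rewrite mul0r cos0.
have -> : k.+1%:R * pi = k%:R * pi + pi :> R by rewrite -natr1; ring.
by rewrite cosDpi IH exprS mulN1r.
Qed.

Lemma natr_pi_gt0 (k : nat) : (0 < k)%N -> 0 < k%:R * pi :> R.
Proof. by move=> k0; rewrite mulr_gt0 ?ltr0n ?pi_gt0. Qed.

Lemma cvg_natr_pi : (k%:R * pi : R) @[k --> \oo] --> +oo.
Proof.
apply: (@cvg_comp _ _ _ (fun k : nat => k%:R : R) (fun r : R => r * pi) _ +oo); first exact: cvgr_idn.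
by apply: gt0_cvgMly; [exact: pi_gt0|exact: cvg_id].
Qed.

(** Multiplied by K^(1-p), the error Gamma (p + 1) / K^2 of
[integral_laplace_osc] becomes Gamma (p + 1) K^(-p-1), and p > -1. *)
Lemma oscillatory_limit p (z : nat -> R) : -1 < p < 1 -> eGamma (p + 1) \is a fin_num ->
  (forall k, (0 < k)%N ->
    (\int[mu]_(u in `]0%R, +oo[) (u `^ p * laplace_osc (k%:R * pi) ((-1) ^+ k) u)%:E = (z k)%:E)%E) ->
  (k%:R * pi) `^ (1 - p) * z k @[k --> \oo] --> pi / (2 * sin (pi * ((p + 1) / 2))).
Proof.
move=> p11 Gfin hz; set m := pi / _.
apply/subr_cvg0; apply/norm_cvg0P.
apply: (@squeeze_cvgr _ _ _ _ (fun=> 0)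
  (fun k => Gamma (p + 1) * (k%:R * pi) `^ (- (p + 1)))).
- near=> k; have k0 : (0 < k)%N by near: k; exact: nbhs_infty_gt.
  have K0 := natr_pi_gt0 k0; set K := k%:R * pi in K0 *.
  rewrite normr_ge0/=.
  have [|y Ey] := @integral_laplace_osc R p K ((-1) ^+ k) K0 p11 _ Gfin.
    by rewrite normrX normrN1 expr1n.
  have -> : y = z k by move: Ey; rewrite hz// => -[].
  rewrite -/m => h.
  have -> : K `^ (1 - p) * z k - m = K `^ (1 - p) * (z k - K `^ (p - 1) * m).
    by rewrite mulrBr mulrA -powR_gt0D// (_ : 1 - p + (p - 1) = 0) ?powRr0 ?mul1r//; ring.
  rewrite normrM ger0_norm ?powR_ge0//.
  apply: le_trans (ler_wpM2l (powR_ge0 _ _) h) _.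
  rewrite mulrCA ler_wpM2l ?fine_ge0 ?eGamma_ge0//.
  rewrite -(powR_invn 2 (ltW K0)) -powR_gt0D// (_ : 1 - p + - 2%:R = - (p + 1))//; ring.
- exact: cvg_cst.
- rewrite -[X in _ --> X](mulr0 (Gamma (p + 1))); apply: cvgM; first exact: cvg_cst.
  apply: (@cvg_comp _ _ _ (fun k : nat => k%:R * pi : R) (fun u => u `^ (- (p + 1))) _ +oo).
    exact: cvg_natr_pi.
  by apply: powRN_cvgy0; case/andP: p11; lra.
Unshelve. all: by end_near. Qed.

Lemma mellin_cos a K s : 0 < a < 1 -> 0 < K -> sin K = 0 -> cos K = s -> `|s| <= 1 ->
  (\int[mu]_(u in `]0%R, +oo[) (u `^ (1 - a) * laplace_osc K s u)%:E =
   (Gamma (1 - a) * \int[mu]_(t in `]0, 1]) (t `^ (a - 1) * cos (K * t)))%:E)%E.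
Proof.
move=> a01 K0 sK cK s1.
rewrite -(@mellin_laplace R a (fun t => cos (K * t)) (fun u => u * laplace_osc K s u))//.
- apply: eq_integral => u; rewrite inE/= in_itv/= andbT => u0; congr EFin.
  by rewrite (addrC 1) powR_gt0D// powRr1 ?ltW// mulrA.
- exact: continuous_cosK.
- by move=> t; exact: cos_max.
- by move=> u u0; exact: integral_laplace_cos.
- by move=> u u0; rewrite mulr_ge0 ?(ltW u0)// laplace_osc_ge0.
- by move=> u u0; apply: cvgM; [exact: cvg_id|exact: continuous_laplace_osc].
Qed.

Lemma mellin_sin a K s : 0 < a < 1 -> 0 < K -> sin K = 0 -> cos K = s -> `|s| <= 1 ->
  (\int[mu]_(u in `]0%R, +oo[) (u `^ (- a) * laplace_osc K s u)%:E =
   (Gamma (1 - a) * (K^-1 * \int[mu]_(t in `]0, 1]) (t `^ (a - 1) * sin (K * t))))%:E)%E.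
Proof.
move=> a01 K0 sK cK s1.
rewrite mulrCA EFinM -(@mellin_laplace R a (fun t => sin (K * t)) (fun u => K * laplace_osc K s u))//.
- rewrite -ge0_integralZl_EFin ?invr_ge0 ?(ltW K0)//=.
  + apply: eq_integral => u _; rewrite -EFinM; congr EFin.
    by field; rewrite gt_eqF.
  + by move=> u; rewrite in_itv/= andbT => u0; rewrite lee_fin mulr_ge0 ?powR_ge0// mulr_ge0 ?(ltW K0)// laplace_osc_ge0.
  + apply: measurable_continuous_pos => // u u0; apply: cvgM; first exact: powR_continuous.
    by apply: cvgM; [exact: cvg_cst|exact: continuous_laplace_osc].
- exact: continuous_sinK.
- by move=> t; exact: sin_max.
- by move=> u u0; exact: integral_laplace_sin.
- by move=> u u0; rewrite mulr_ge0 ?(ltW K0)// laplace_osc_ge0.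
- by move=> u u0; apply: cvgM; [exact: cvg_cst|exact: continuous_laplace_osc].
Qed.

Lemma sin_le_id u : 0 <= u -> `|sin u| <= u.
Proof.
rewrite le_eqVlt => /predU1P[<-|u0]; first by rewrite sin0 normr0.
have [|c _] := @MVT R sin cos 0 u u0 (fun t _ => is_derive_sin t).
  by apply: continuous_subspaceT; exact: continuous_sin.
rewrite sin0 !subr0 => ->; rewrite normrM (ger0_norm (ltW u0)) ler_piMl ?cos_max//.
exact: ltW.
Qed.

(** The primitive t^a sin (K t) / K vanishes at both ends. Its derivative has a
term in t^(a-1) sin (K t), which tends to 0 at 0 since |sin (K t)| <= K t, so
that the fundamental theorem of calculus applies on the closed interval. *)
Lemma cos_by_parts a K : 0 < a -> 0 < K -> sin K = 0 ->
  - (\int[mu]_(t in `[0, 1]) (t `^ a * cos (K * t))) =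
  a / K * \int[mu]_(t in `]0, 1]) (t `^ (a - 1) * sin (K * t)).
Proof.
move=> a0 K0 sK.
pose F t : R := t `^ a * (sin (K * t) / K).
pose f t : R := t `^ a * cos (K * t) + a / K * (t `^ (a - 1) * sin (K * t)).
have dF (t : R) : 0 < t -> is_derive t 1 F (f t).
  move=> t0; have d1 := is_derive1_powR a t0; have d2 := is_derive_sinK K t.
  apply: is_derive_eq; rewrite /GRing.scale/= /f; field.
  by rewrite gt_eqF.
have cf (t : R) : 0 < t -> {for t, continuous f}.
  move=> t0; apply: cvgD.
    by apply: cvgM; [exact: powR_continuous|exact: continuous_cosK].
  apply: cvgM; first exact: cvg_cst.
  by apply: cvgM; [exact: powR_continuous|exact: continuous_sinK].
(* Here 0 `^ (a - 1) is 0 or 1 by convention; sin (K * 0) = 0 makes its value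
   immaterial. *)
have f0 : f 0 = 0 by rewrite /f powR0 ?gt_eqF// mul0r mulr0 sin0 !mulr0 addr0.
have F0 : F 0 = 0 by rewrite /F powR0 ?gt_eqF// mul0r.
have F1 : F 1 = 0 by rewrite /F mulr1 sK mul0r mulr0.
have f0' : f x @[x --> 0^'+] --> f 0.
  rewrite f0; apply/norm_cvg0P.
  apply: (@squeeze_cvgr _ _ _ _ (fun=> 0) (fun t => (1 + a) * t `^ a)).
  - near=> t; have t0 : 0 < t by [].
    rewrite normr_ge0/=; apply: le_trans (ler_normD _ _) _.
    rewrite mulrDl mul1r lerD//.
      by rewrite normrM (ger0_norm (powR_ge0 _ _)) ler_piMr ?powR_ge0 ?cos_max.
    have aK : 0 <= a / K by rewrite divr_ge0 ?ltW.
    rewrite normrM (ger0_norm aK) normrM (ger0_norm (powR_ge0 _ _)).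
    have := sin_le_id (mulr_ge0 (ltW K0) (ltW t0)) => h.
    apply: (@le_trans _ _ (a / K * (t `^ (a - 1) * (K * t)))).
      by rewrite ler_wpM2l// ler_wpM2l ?powR_ge0.
    rewrite le_eqVlt; apply/orP; left; apply/eqP.
    rewrite -[in RHS](subrK 1 a) (powR_gt0D _ 1 t0) powRr1 ?ltW//; field.
    by rewrite gt_eqF.
  - exact: cvg_cst.
  - rewrite -[X in _ --> X](mulr0 (1 + a)); apply: cvgM; first exact: cvg_cst.
    exact: powR_cvg0.
have F0' : F x @[x --> 0^'+] --> F 0.
  rewrite F0 -[X in _ --> X](mul0r (sin (K * 0) / K)); apply: cvgM; first exact: powR_cvg0.
  apply: cvg_at_right_filter; apply: cvgM; last exact: cvg_cst.
  exact: continuous_sinK.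
have I : (\int[mu]_(t in `[0%R, 1%R]) (f t)%:E = 0)%E.
  rewrite (@continuous_FTC2 _ f F)//.
  - by rewrite F0 F1 sube0.
  - apply/continuous_within_itvP => //; split => //.
      by move=> t; rewrite in_itv/= => /andP[t0 _]; exact: cf.
    by apply: cvg_at_left_filter; apply: cf.
  - split => //.
      by move=> t; rewrite in_itv/= => /andP[t0 _]; apply: ex_derive; exact: dF.
    by apply: cvg_at_left_filter; apply: is_derive_continuous; exact: dF.
  - by move=> t; rewrite in_itv/= => /andP[t0 _]; rewrite derive1E; apply: derive_val; exact: dF.
have Ic := @integrable_powR_osc R (a + 1) (fun t => cos (K * t)) (addr_gt0 a0 ltr01) (@continuous_cosK R K) (fun t => cos_max _).
have Is := @integrable_powR_osc R a (fun t => sin (K * t)) a0 (@continuous_sinK R K) (fun t => sin_max _).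
have mf : measurable_fun setT (fun t : R => t `^ a * cos (K * t)).
  apply: measurable_funM; first exact: measurable_powR_fun.
  by apply: continuous_measurable_fun; exact: continuous_cosK.
have ms : measurable_fun setT (fun t : R => t `^ (a - 1) * sin (K * t)).
  apply: measurable_funM; first exact: measurable_powR_fun.
  by apply: continuous_measurable_fun; exact: continuous_sinK.
have {}I : \int[mu]_(t in `]0, 1]) f t = 0.
  rewrite /Rintegral integral_itv_obnd_cbnd ?I//.
  apply/measurable_EFinP; apply: measurable_funTS; apply: measurable_funD => //.
  exact: measurable_funM.
have {}Ic : mu.-integrable `]0, 1] (EFin \o (fun t => t `^ a * cos (K * t))).
  by apply: eq_integrable Ic => // t _; rewrite addrK.
move: I; rewrite /f RintegralD//; last first.
- rewrite [X in _.-integrable _ X](_ : _ = (fun t => (a / K)%:E * (t `^ (a - 1) * sin (K * t))%:E)%E) //.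
  exact: integrableZl.
rewrite RintegralZl// => /eqP; rewrite addrC addr_eq0 => /eqP ->.
by rewrite -Rintegral_itv_obnd_cbnd.
Unshelve. all: by end_near. Qed.

End asymptotics.

(** * The coefficients *)

Section coefficients.
Context {R : realType}.
Notation mu := (@lebesgue_measure R).
Implicit Types (a x H : R).

Lemma sin_pi_sub x : sin (pi - x) = sin x :> R.
Proof. by rewrite sinB sinpi cospi mul0r sub0r mulN1r opprK. Qed.

(** The two limits, obtained as integrals of u^p / (u^2 + 1), in terms of the
Gamma function; combine reflection with sin (pi a) = 2 sin (pi a / 2)
cos (pi a / 2). *)
Lemma reflection_half a : 0 < a < 1 ->
  pi / (2 * sin (pi * ((1 - a) / 2))) = Gamma a * Gamma (1 - a) * sin (pi * (a / 2)) :> R.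
Proof.
move=> a01; rewrite Gamma_reflection//.
have h01 : 0 < a / 2 < 1 by have /andP[a0 a1] := a01; apply/andP; split; lra.
have -> : pi * ((1 - a) / 2) = pi - (pi * (a / 2) + pi / 2) :> R by field.
have E : pi * a = (pi * (a / 2)) *+ 2 :> R by rewrite mulr2n; field.
have := sin_pi_gt0 a01; rewrite E sin_mulr2n sin_pi_sub sinDpihalf.
have := lt0r_neq0 (sin_pi_gt0 h01).
set s := sin _; set c := cos _; set q := @pi R; clearbody s c q => s0 sc.
have c0 : c != 0 by apply/eqP => c0; move: sc; rewrite c0 mul0r mul0rn ltxx.
by rewrite mulr2n; field; rewrite s0 c0.
Qed.

Lemma sign_norm_le1 (k : nat) : `|(-1) ^+ k| <= 1 :> R.
Proof. by rewrite normrX normrN1 expr1n. Qed.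

(** In both regimes the quotient is a constant times a sequence to which
[oscillatory_limit] applies, and the constant is the inverse of the limit. *)
Lemma b_coef_asymp H : 0 < H -> H < 1 -> H <> 1 / 2 ->
  asymp_equiv (b_coef H)
    (fun k : nat => Gamma (2 * H + 1) * sin (pi * H) * (k%:R * pi) `^ (- (2 * H) - 1)).
Proof.
move=> H0 H1 Hn; rewrite /asymp_equiv.
pose C : R := Gamma (2 * H + 1) * sin (pi * H).
suff [p [c [z [p11 Gp [cm zE bE]]]]] : exists p (c : R) (z : nat -> R),
    [/\ -1 < p < 1, eGamma (p + 1) \is a fin_num &
     [/\ c * (pi / (2 * sin (pi * ((p + 1) / 2)))) = 1,
      forall k, (0 < k)%N -> (\int[mu]_(u in `]0%R, +oo[)
         (u `^ p * laplace_osc (k%:R * pi) ((-1) ^+ k) u)%:E = (z k)%:E)%E &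
      forall k, (0 < k)%N -> b_coef H k / (C * (k%:R * pi) `^ (- (2 * H) - 1)) =
         c * ((k%:R * pi) `^ (1 - p) * z k)]].
  have L := oscillatory_limit p11 Gp zE.
  have {}L : c * ((k%:R * pi) `^ (1 - p) * z k) @[k --> \oo] -->
      c * (pi / (2 * sin (pi * ((p + 1) / 2)))).
    by apply: cvgM; [exact: cvg_cst|exact: L].
  rewrite cm in L.
  apply: cvg_trans L; apply: near_eq_cvg; near=> k; rewrite bE//.
  by near: k; exact: nbhs_infty_gt.
have s01 : 0 < H < 1 by rewrite H0.
have sn0 := lt0r_neq0 (sin_pi_gt0 s01).
have [Hlt|Hge] := ltP H (1 / 2).
  pose a := 2 * H; have a01 : 0 < a < 1 by apply/andP; split; rewrite /a; lra.
  have [a0 a1] := andP a01.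
  have b01 : 0 < 1 - a < 1 by apply/andP; split; lra.
  have G0 := lt0r_neq0 (Gamma_gt0 a01); have G1 := lt0r_neq0 (Gamma_gt0 b01).
  exists (- a), ((Gamma a * Gamma (1 - a) * sin (pi * H))^-1),
    (fun k => Gamma (1 - a) * ((k%:R * pi)^-1 *
      \int[mu]_(t in `]0, 1]) (t `^ (a - 1) * sin (k%:R * pi * t)))); split.
  - by apply/andP; split; lra.
  - by rewrite addrC eGamma_fin_num.
  split.
  - rewrite (addrC _ 1) reflection_half// (_ : a / 2 = H); last by rewrite /a; field.
    by rewrite mulVf// !mulf_neq0.
  - move=> k k0; apply: mellin_sin => //.
    + exact: natr_pi_gt0.
    + exact: sin_natr_pi.
    + exact: cos_natr_pi.
    + exact: sign_norm_le1.
  - move=> k k0; have K0 := natr_pi_gt0 (R := R) k0.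
    rewrite /b_coef Hlt -/a (cos_by_parts a0 K0 (sin_natr_pi k)).
    rewrite /C -/a Gamma_add1// opprK (_ : - a - 1 = - (1 + a)); last by ring.
    rewrite powRN; have P0 := lt0r_neq0 (powR_gt0 (1 + a) K0).
    move: P0 (lt0r_neq0 K0) (lt0r_neq0 a0) G0 G1 sn0.
    set P := _ `^ (1 + a); set K := k%:R * pi; set X := Rintegral _ _ _.
    set g := Gamma _; set g' := Gamma _; set s := sin _; clearbody P K X g g' s a.
    by move=> P0 Kn0 an0 G0 G1 S0; field; rewrite P0 Kn0 an0 G0 G1 S0.
have {Hge}Hgt : 1 / 2 < H by rewrite lt_neqAle Hge andbT; apply/eqP => /esym.
pose a := 2 * H - 1; have a01 : 0 < a < 1 by apply/andP; split; rewrite /a; lra.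
have [a0 a1] := andP a01.
have b01 : 0 < 1 - a < 1 by apply/andP; split; lra.
have G0 := lt0r_neq0 (Gamma_gt0 a01); have G1 := lt0r_neq0 (Gamma_gt0 b01).
exists (1 - a), ((Gamma a * Gamma (1 - a) * sin (pi * H))^-1),
  (fun k => Gamma (1 - a) * \int[mu]_(t in `]0, 1]) (t `^ (a - 1) * cos (k%:R * pi * t))); split.
- by apply/andP; split; lra.
- have b0 : 0 < 1 - a by case/andP: b01.
  by rewrite eGamma_add1// fin_numM// eGamma_fin_num.
split.
- have -> : pi * ((1 - a + 1) / 2) = pi - pi * ((1 - (1 - a)) / 2) by field.
  rewrite sin_pi_sub reflection_half// (_ : 1 - (1 - a) = a); last by ring.
  have -> : pi * ((1 - a) / 2) = pi - pi * H by rewrite /a; field.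
  by rewrite sin_pi_sub (mulrC (Gamma (1 - a))) mulVf// !mulf_neq0.
- move=> k k0; apply: mellin_cos => //.
  + exact: natr_pi_gt0.
  + exact: sin_natr_pi.
  + exact: cos_natr_pi.
  + exact: sign_norm_le1.
- move=> k k0; have K0 := natr_pi_gt0 (R := R) k0.
  have HE : 2 * H = a + 1 by rewrite /a; ring.
  rewrite /b_coef ltNge (ltW Hgt)/= (_ : 2 * H - 2 = a - 1); last by rewrite /a; ring.
  rewrite /C HE (Gamma_add1 (addr_gt0 a0 ltr01)) (Gamma_add1 a0).
  rewrite (_ : - (a + 1) - 1 = - (a + 2)); last by ring.
  rewrite powRN (powR_gt0D _ _ K0) (powR_mulrn 2 (ltW K0)) (_ : 1 - (1 - a) = a); last by ring.
  have P0 := lt0r_neq0 (powR_gt0 a K0); have a10 : a + 1 != 0 by rewrite gt_eqF// addr_gt0.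
  move: P0 (lt0r_neq0 K0) (lt0r_neq0 a0) a10 G0 G1 sn0.
  set P := _ `^ a; set K := k%:R * pi; set X := Rintegral _ _ _.
  set g := Gamma _; set g' := Gamma _; set s := sin _; clearbody P K X g g' s.
  clear HE; clearbody a.
  by move=> P0 Kn0 an0 a10 G0 G1 S0; field; rewrite P0 Kn0 an0 a10 G0 G1 S0.
Unshelve. all: by end_near. Qed.

End coefficients.

Theorem lemma3p4 (R : realType) :
  (forall H : R, 1 / 2 < H -> H < 1 ->
     b_zero H / a_zero H = Gamma (2 * H + 1) * sin (pi * H)) /\
  (forall H : R, 0 < H -> H < 1 -> H <> 1 / 2 ->
     asymp_equiv (b_coef H)
       (fun k : nat =>
          Gamma (2 * H + 1) * sin (pi * H) * (k%:R * pi) `^ (- (2 * H) - 1))).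
Proof. by split; [exact: b_zero_div_a_zero|exact: b_coef_asymp]. Qed.
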